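(* Let $1<q\le p<\infty$. Then the predual space of $\mathcal{B}^{p'}_{q'}(\mathbb{R}^n)$ is $\widetilde{\mathcal{M}}^p_q(\mathbb{R}^n)$ in the following sense. If $g\in\mathcal{B}^{p'}_{q'}(\mathbb{R}^n)$, then $f\mapsto\int_{\mathbb{R}^n}f(x)g(x)\,dx$ is an element of $\widetilde{\mathcal{M}}^p_q(\mathbb{R}^n)^{*}$. Moreover, for any $L\in\widetilde{\mathcal{M}}^p_q(\mathbb{R}^n)^{*}$, there exists $g\in\mathcal{B}^{p'}_{q'}(\mathbb{R}^n)$ such that $$L(f)=\int_{\mathbb{R}^n}f(x)g(x)\,dx\qquad (f\in\widetilde{\mathcal{M}}^p_q(\mathbb{R}^n)).$$
   Context: For $1<r<\infty$, $r'$ denotes the conjugate exponent, $1/r+1/r'=1$. $\mathcal{Q}$ is the family of all cubes in $\mathbb{R}^n$ with sides parallel to the coordinate axes, and $|Q|$ is the volume of $Q$. $X^*$ denotes the dual space (bounded linear functionals) of a normed space $X$. Let $1<q\le p<\infty$. The Morrey space $\mathcal{M}^p_q(\mathbb{R}^n)$ is the set of all $f\in L^q_{\rm loc}(\mathbb{R}^n)$ for which $$\|f\|_{\mathcal{M}^p_q(\mathbb{R}^n)}:=\sup_{Q\in\mathcal{Q}}|Q|^{\frac1p-\frac1q}\left(\int_Q|f(x)|^q\,dx\right)^{1/q}$$ is finite. $\widetilde{\mathcal{M}}^p_q(\mathbb{R}^n)$ denotes the closure in $\mathcal{M}^p_q(\mathbb{R}^n)$ of the set of all finite linear combinations of characteristic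 functions of sets of finite measure. A function $b$ on $\mathbb{R}^n$ is a $(p',q')$-block provided that $b$ is supported on a cube $Q\in\mathcal{Q}$ and satisfies $$\left(\int_Q |b(x)|^{q'}\,dx\right)^{1/q'}\le |Q|^{\frac1p-\frac1q}.$$ The block space $\mathcal{B}^{p'}_{q'}(\mathbb{R}^n)$ is the set of all functions $f$ locally in $L^{q'}(\mathbb{R}^n)$ with the norm $$\|f\|_{\mathcal{B}^{p'}_{q'}(\mathbb{R}^n)}:=\inf\left\{\|\{\lambda_k\}\|_{\ell^1}:\ f=\sum_k\lambda_k b_k\right\}<\infty,$$ where $\|\{\lambda_k\}_{k=1}^\infty\|_{\ell^1}=\sum_k|\lambda_k|<\infty$, each $b_k$ is a $(p',q')$-block, and the infimum is taken over all possible decompositions of $f$.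
   Formalization: The block space is taken as all measurable functions with finite block norm, without requiring them to be locally in L^{q'}; with that requirement the second claim fails for q<p, since sums of blocks on shrinking cubes need not be locally in L^{q'}. *)

(* Defs.v *)
From HB Require Import structures.
From mathcomp Require Import all_boot all_order all_algebra.
From mathcomp Require Import all_classical all_reals all_analysis.

Set Implicit Arguments.
Unset Strict Implicit.
Unset Printing Implicit Defensive.
Import Order.TTheory GRing.Theory Num.Theory.
Import numFieldNormedType.Exports.

Local Open Scope classical_set_scope.
Local Open Scope ring_scope.

(* R^n carries the library's product sigma-algebra on tuples of reals, i.e. the
   Borel sigma-algebra. *)
Notation Rn R n := (n.-tuple (measurableTypeR R)).

(* Lebesgue measure on R^n, by recursion on n: a point mass on R^0, and on
   R^(n+1) the image of the product measure on R * R^n under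
   (x, t) |-> x :: t. *)
Lemma product_sigma_finite d1 d2 (T1 : measurableType d1) (T2 : measurableType d2)
    (R : realType) (m1 : {sigma_finite_measure set T1 -> \bar R})
    (m2 : {sigma_finite_measure set T2 -> \bar R}) :
  sigma_finite setT (m1 \x m2)%E.
Proof.
have /sigma_finiteP[F [TF ndF Foo]] := sigma_finiteT m1.
have /sigma_finiteP[G [TG ndG Goo]] := sigma_finiteT m2.
exists (fun k => F k `*` G k).
  rewrite -setXTT TF TG predeqE => -[x y]; split; last first.
    by move=> [k _ []/= ? ?]; split; exists k.
  move=> [/= [k _ Fx] [j _ Gy]]; exists (maxn k j) => //; split.
  - by move: x Fx; exact/subsetPset/ndF/leq_maxl.
  - by move: y Gy; exact/subsetPset/ndG/leq_maxr.
move=> k; have [? ?] := Foo k; have [? ?] := Goo k.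
split; first exact: measurableX.
by rewrite product_measure1E// lte_mul_pinfty// ge0_fin_numE.
Qed.

Section lebesgue_step.
Context (R : realType) (n : nat) (mu : {sigma_finite_measure set (Rn R n) -> \bar R}).

Definition tcons (z : measurableTypeR R * Rn R n) : Rn R n.+1 :=
  [the n.+1.-tuple (measurableTypeR R) of z.1 :: z.2].

Lemma measurable_tcons : measurable_fun [set: measurableTypeR R * Rn R n] tcons.
Proof. exact: measurable_cons. Qed.

Definition lebesgue_step : set (Rn R n.+1) -> \bar R :=
  pushforward (@lebesgue_measure R \x mu)%E tcons.

Let step0 : lebesgue_step set0 = 0%E.
Proof. by rewrite /lebesgue_step /pushforward preimage_set0 measure0. Qed.

Let step_ge0 A : (0 <= lebesgue_step A)%E.
Proof. exact: (measure_ge0 (@lebesgue_measure R \x mu)%E). Qed.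

Let step_sigma_additive : semi_sigma_additive lebesgue_step.
Proof.
move=> F mF tF mUF; rewrite /lebesgue_step /pushforward preimage_bigcup.
apply: measure_semi_sigma_additive.
- by move=> k; rewrite -[X in measurable X]setTI; exact: measurable_tcons.
- apply/trivIsetP => /= i j _ _ ij; rewrite -preimage_setI.
  by move/trivIsetP : tF => /(_ _ _ _ _ ij) ->//; rewrite preimage_set0.
- by rewrite -preimage_bigcup -[X in measurable X]setTI; exact: measurable_tcons.
Qed.

HB.instance Definition _ :=
  isMeasure.Build _ _ _ lebesgue_step step0 step_ge0 step_sigma_additive.

Let step_sigma_finite : sigma_finite setT lebesgue_step.
Proof.
have [F TF mF] : sigma_finite setT (@lebesgue_measure R \x mu)%E.
  exact: product_sigma_finite.
pose g (x : Rn R n.+1) : measurableTypeR R * Rn R n :=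
  (thead x, [tuple of behead x]).
have mg : measurable_fun setT g.
  apply/measurable_fun_pairP; split; first exact: (measurable_tnth ord0).
  exact: measurable_behead.
have tK z : g (tcons z) = z.
  by case: z => a b; rewrite /g /tcons; congr pair; exact/val_inj.
exists (fun k => g @^-1` F k).
  by rewrite -preimage_bigcup -TF preimage_setT.
move=> k; have [mFk Fk] := mF k; split.
  by rewrite -[X in measurable X]setTI; exact: mg.
rewrite /lebesgue_step /pushforward -comp_preimage.
by rewrite (_ : g \o tcons = id)//; exact/funext.
Qed.

HB.instance Definition _ :=
  Measure_isSigmaFinite.Build _ _ _ lebesgue_step step_sigma_finite.

End lebesgue_step.

Fixpoint lebesgue_Rn (R : realType) (n : nat) :
    {sigma_finite_measure set (Rn R n) -> \bar R} :=
  match n with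
  | 0 => \d_([tuple] : Rn R 0)
  | m.+1 => lebesgue_step (lebesgue_Rn R m)
  end.

Lemma lebesgue_Rn_box (R : realType) (n : nat) (a b : 'I_n -> R) :
  (forall i, a i <= b i) ->
  lebesgue_Rn R n [set x : Rn R n | forall i, a i <= tnth x i <= b i] =
  (\prod_(i < n) (b i - a i))%:E.
Proof.
elim: n a b => [|n IHn] a b ab.
  rewrite big_ord0 /= diracE mem_set//= => -[[]]//.
rewrite big_ord_recl EFinM /= /lebesgue_step /pushforward.
rewrite (_ : _ @^-1` _ = `[a ord0, b ord0]%classic `*`
    [set x : Rn R n | forall i, a (lift ord0 i) <= tnth x i <= b (lift ord0 i)]); last first.
  apply/seteqP; split => -[x t] /=.
    move=> H; split; first by have := H ord0; rewrite in_itv.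
    by move=> i; have := H (lift ord0 i); rewrite tnthS.
  move=> [H1 H2] i; rewrite in_itv/= in H1.
  by have [j ->|->//] := unliftP ord0 i; rewrite tnthS; exact: H2.
have mB : measurable
    [set x : Rn R n | forall i, a (lift ord0 i) <= tnth x i <= b (lift ord0 i)].
  rewrite (_ : mkset _ = \bigcap_(i in [set: 'I_n])
     ((fun x : Rn R n => tnth x i) @^-1` `[a (lift ord0 i), b (lift ord0 i)]%classic)); last first.
    apply/seteqP; split => x /=; first by move=> H i _ /=; rewrite in_itv; exact: H.
    by move=> H i; have := H i I; rewrite /= in_itv.
  apply: fin_bigcap_measurable; first exact: finite_finset.
  move=> i _; rewrite -[X in measurable X]setTI.
  exact: measurable_tnth.
rewrite product_measure1E// IHn//; congr (_ * _)%E.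
rewrite [LHS]lebesgue_measure_itv/= lte_fin; case: ifPn => // /negP H.
have -> : b ord0 = a ord0 by apply/eqP; rewrite eq_le ab andbT leNgt; apply/negP.
by rewrite subrr.
Qed.

Section morrey_block.
Context (R : realType) (n : nat).
Local Notation mu := (lebesgue_Rn R n).

(* Closed cubes; open or half-open cubes differ from these by null sets. *)
Definition cube (Q : set (Rn R n)) : Prop :=
  exists (a : Rn R n) (l : R), 0 < l /\
    Q = [set x | forall i, tnth a i <= tnth x i <= tnth a i + l].

Definition volume (Q : set (Rn R n)) : R := fine (mu Q).

(* Since f \_ Q is extended by zero, this is (\int_Q |f|^r)^(1/r). *)
Definition Lnorm_on (r : \bar R) (Q : set (Rn R n)) (f : Rn R n -> R) : \bar R :=
  'N[mu]_r [EFin \o (f \_ Q)].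

Definition Lloc (r : \bar R) : set (Rn R n -> R) :=
  [set f | measurable_fun setT f /\
           forall Q, cube Q -> (Lnorm_on r Q f < +oo)%E].

Definition morrey_norm (p q : R) (f : Rn R n -> R) : \bar R :=
  ereal_sup [set ((volume Q `^ (p^-1 - q^-1))%:E * Lnorm_on q%:E Q f)%E |
             Q in cube].

Definition morrey (p q : R) : set (Rn R n -> R) :=
  [set f | Lloc q%:E f /\ (morrey_norm p q f < +oo)%E].

Definition finite_simple : set (Rn R n -> R) :=
  [set s | exists (m : nat) (c : 'I_m -> R) (A : 'I_m -> set (Rn R n)),
     (forall i, measurable (A i) /\ (mu (A i) < +oo)%E) /\
     s = (fun x => \sum_(i < m) c i * \1_(A i) x)].

Definition morrey_tilde (p q : R) : set (Rn R n -> R) :=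
  [set f | morrey p q f /\
     forall e : R, 0 < e ->
       exists2 s, finite_simple s & (morrey_norm p q (f \- s)%R < e%:E)%E].

(* (p', q')-blocks, where p' and q' are the conjugate exponents of p and q. *)
Definition block (p q : R) (b : Rn R n -> R) : Prop :=
  measurable_fun setT b /\
  exists Q, [/\ cube Q, forall x, ~ Q x -> b x = 0 &
    (Lnorm_on (hoelder_conjugate q%:E) Q b
       <= (volume Q `^ (p^-1 - q^-1))%:E)%E].

Definition l1_norm (lambda : nat -> R) : \bar R :=
  (\sum_(0 <= k <oo) `|lambda k|%:E)%E.

Definition block_decomposition (p q : R) (f : Rn R n -> R)
    (lambda : nat -> R) (b : nat -> Rn R n -> R) : Prop :=
  [/\ forall k, block p q (b k), (l1_norm lambda < +oo)%E &
      {ae mu, forall x, series (fun k => lambda k * b k x) @ \oo --> f x}].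

(* The norm of B^{p'}_{q'}. *)
Definition block_norm (p q : R) (f : Rn R n -> R) : \bar R :=
  ereal_inf [set l1_norm lambda | lambda in
    [set lambda | exists b, block_decomposition p q f lambda b]].

(* B^{p'}_{q'}. The ambient class is that of all measurable functions, not
   L^{q'}_loc: if q < p, then a sum \sum_k lambda_k b_k with (lambda_k) in l^1
   always lies in L^{p'} but need not be locally in L^{q'}, and intersecting
   with L^{q'}_loc would give a space that is not complete. *)
Definition block_space (p q : R) : set (Rn R n -> R) :=
  [set f | measurable_fun setT f /\ (block_norm p q f < +oo)%E].

(* Bounded linear functionals on the subspace X with seminorm N. Functions are
   not quotiented by a.e. equality: a bounded L takes equal values on f and g
   when N (f - g) = 0, so these are exactly the elements of the dual of the
   quotient normed space. *)
Definition dual (X : set (Rn R n -> R)) (N : (Rn R n -> R) -> \bar R) :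
    set ((Rn R n -> R) -> R) :=
  [set L | (forall (c : R) f g, X f -> X g ->
              L (fun x => c * f x + g x) = c * L f + L g) /\
           exists C : R, forall f, X f -> (`|L f|%:E <= C%:E * N f)%E].

End morrey_block.

(* Main.v *)
From HB Require Import structures.
Require Import Defs.
From mathcomp Require Import all_boot all_order all_algebra.
From mathcomp Require finmap.
From mathcomp Require Import all_classical all_reals all_analysis.
From mathcomp Require Import measurable_realfun zify.

Set Implicit Arguments.
Unset Strict Implicit.
Unset Printing Implicit Defensive.
Import Order.TTheory GRing.Theory Num.Theory.
Import numFieldNormedType.Exports.
Local Open Scope classical_set_scope.
Local Open Scope ring_scope.

(** Hoelder's inequality on the cube carrying a block bounds the integral of
    |f b| by the Morrey norm of f, whatever the block b is. Hence a series of
    blocks with l^1 coefficients pairs absolutely with every Morrey function,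
    and dominated convergence allows integration term by term
    ([decomposition_pairing]). This is the first half of the theorem.

    For the second half, a bounded functional L is written on simple functions
    as a sum of functionals L_k, where L_k only sees f on one cube Q_k and
      |L_k f| <= c_k |Q_k|^(1/p - 1/q) ||f||_(L^q(Q_k)),  sum_k c_k < oo.
    By duality of L^q(Q_k), proved from the Radon-Nikodym theorem in
    [riesz_density], L_k is integration against a function of L^q'-norm at most
    c_k |Q_k|^(1/p - 1/q) on Q_k, that is, against c_k times a block. The sum of
    these functions lies in the block space and represents L on simple
    functions, hence on their closure ([dual_of_local_functionals]).

    The splitting of L depends on whether q < p.

    If q < p, the Morrey norm is equivalent to the supremum of the seminorms
    N_k f = |Q_k|^(1/p - 1/q) ||f||_(L^q(Q_k)) over a countable grid of cubes, and
    N_k f tends to 0 when f is simple: on small cubes because f is bounded, on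
    large cubes because f is in L^q and the weight decays, and on the cubes of
    a fixed size far from the origin because f has support of finite measure. So
    simple functions embed in a c_0-sum of spaces L^q(Q_k). The functional L is
    extended to bounded families by the Hahn-Banach theorem, and its restriction
    to the c_0-sum is an element of the l^1-sum of the dual spaces
    ([sup_seminorm_decomposition], [predual_strict]).

    If q = p, the weight is 1 and the seminorms of large cubes do not decay, but
    the norm is that of L^q. As q > 1, adding up N disjointly supported
    functions of norm at most 1 gives a norm of at most N^(1/q) = o(N), so L has
    arbitrarily small norm on functions supported far away
    ([tail_functional_small]). Restricting L to annuli with quickly growing radii
    is then a splitting with geometrically decreasing c_k ([predual_equal]). *)

(** * The Hahn-Banach theorem and functionals bounded by a supremum of seminorms *)

Section hahn_banach.
Context {R : realType} {V : lmodType R} (W : set V) (p : V -> R).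
Hypothesis W0 : W 0.
Hypothesis W_lin : forall a x y, W x -> W y -> W (a *: x + y).
Hypothesis p_subadd : forall x y, W x -> W y -> p (x + y) <= p x + p y.
Hypothesis p_homog : forall a x, 0 < a -> W x -> p (a *: x) = a * p x.

(** A linear functional on a subspace is handled as its graph, so that partial
    functionals are ordered by inclusion and the union of a chain of them is the
    plain union of sets. Being single-valued follows from the bound by [p]. *)
Definition dominated_graph (G : set (V * R)) : Prop :=
  [/\ G (0, 0),
      forall a u v, G u -> G v -> G (a *: u.1 + v.1, a * u.2 + v.2) &
      forall u, G u -> W u.1 /\ u.2 <= p u.1].

Let p0 : p 0 = 0.
Proof.
have := @p_homog 2 0 (ltr0n _ 2) W0; rewrite scaler0 mulrDl mul1r => /eqP.
by rewrite -subr_eq subrr => /eqP.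
Qed.

(** The difference of two values at v is a value at 0, which is at most [p 0] = 0. *)
Lemma dominated_graph_fun G v r s :
  dominated_graph G -> G (v, r) -> G (v, s) -> r = s.
Proof.
move=> [G00 Glin Gdom].
suff H r' s' : G (v, r') -> G (v, s') -> r' <= s'.
  by move=> ? ?; apply/eqP; rewrite eq_le !H.
move=> Gr Gs; have := Glin (-1) _ _ Gs Gr.
rewrite /= scaleN1r addNr mulN1r addrC => /Gdom[_ /=].
by rewrite p0 subr_le0.
Qed.

(** The value at the new vector x can be any number between all r - p (v - x) and
    all p (v + x) - r, with (v, r) in the graph; subadditivity of [p] says that the
    former are below the latter. *)
Lemma dominated_graph_extend G x : dominated_graph G -> W x ->
  exists2 G', dominated_graph G' & G `<=` G' /\ exists r, G' (x, r).
Proof.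
move=> [G00 Glin Gdom] Wx.
pose A := [set u.2 - p (u.1 - x) | u in G].
have Wlin1 a y : W y -> W (y + a *: x).
  by move=> Wy; rewrite addrC; exact: W_lin.
have AB v w : G v -> G w -> v.2 - p (v.1 - x) <= p (w.1 + x) - w.2.
  move=> Gv Gw; have := Glin 1 _ _ Gv Gw; rewrite !scale1r mul1r => /Gdom/= [_ H].
  have [Wv _] := Gdom _ Gv; have [Ww _] := Gdom _ Gw.
  rewrite lerBrDr addrAC lerBlDr (le_trans H)//.
  rewrite (_ : v.1 + w.1 = (w.1 + x) + (v.1 - x)); last by rewrite addrACA subrr addr0 addrC.
  apply: p_subadd; first by rewrite -[x in _ + x]scale1r; exact: Wlin1.
  by rewrite -scaleN1r; exact: Wlin1.
have A_ub w : G w -> ubound A (p (w.1 + x) - w.2).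
  by move=> Gw _ [v Gv <-]; exact: AB.
have A0 : A !=set0 by exists (0 - p (0 - x)); exists (0, 0).
have supA : has_sup A by split => //; exists (p (0 + x) - 0); apply: (A_ub (0, 0)).
pose s := sup A.
have sl v : G v -> v.2 - p (v.1 - x) <= s.
  by move=> Gv; apply: (ub_le_sup supA.2); exists v.
have sr v : G v -> s <= p (v.1 + x) - v.2.
  by move=> Gv; apply: (sup_le_ub A0); exact: A_ub.
exists [set u | exists v t, G v /\ u = (v.1 + t *: x, v.2 + t * s)].
  split.
  - by exists (0, 0), 0; split => //=; rewrite scale0r mul0r !addr0.
  - move=> a _ _ [v [t [Gv ->]]] [w [t' [Gw ->]]] /=.
    exists (a *: v.1 + w.1, a * v.2 + w.2), (a * t + t'); split; first exact: Glin.
    by rewrite /= scalerDr scalerA mulrDr mulrA scalerDl mulrDl; congr pair;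
      rewrite addrACA.
  - move=> _ [v [t [Gv ->]]] /=; have [Wv vp] := Gdom _ Gv.
    split; first exact: Wlin1.
    have scaled a : 0 < a -> G (a^-1 *: v.1, a^-1 * v.2).
      by move=> a0; have := Glin a^-1 _ _ Gv G00; rewrite /= !addr0.
    have [t0|t0|->] := ltgtP t 0; last by rewrite scale0r mul0r !addr0.
    + have Nt : 0 < - t by rewrite oppr_gt0.
      have /sl/= := scaled _ Nt.
      have -> : v.1 + t *: x = - t *: ((- t)^-1 *: v.1 - x).
        by rewrite scalerBr scalerA divff ?gt_eqF// scale1r scaleNr opprK.
      rewrite p_homog//; last first.
        by rewrite -scaleN1r; apply: Wlin1; exact: (Gdom _ (scaled _ Nt)).1.
      rewrite lerBlDr -lerBlDl -(ler_pM2l Nt) mulrBr mulrA divff ?gt_eqF// mul1r.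
      by rewrite mulNr opprK.
    + have /sr/= := scaled _ t0.
      have -> : v.1 + t *: x = t *: (t^-1 *: v.1 + x).
        by rewrite scalerDr scalerA divff ?gt_eqF// scale1r.
      rewrite p_homog//; last first.
        by rewrite -[x in _ + x]scale1r; apply: Wlin1; exact: (Gdom _ (scaled _ t0)).1.
      by rewrite lerBrDr addrC -(ler_pM2l t0) mulrDr mulrA divff ?gt_eqF// mul1r.
split.
  by move=> v Gv; exists v, 0; split => //; rewrite scale0r mul0r !addr0 -surjective_pairing.
by exists s, (0, 0), 1; split => //=; rewrite scale1r mul1r !add0r.
Qed.

(** Zorn's lemma is applied to the sets [G] whose union with [G0] is a dominated
    graph; the union keeps the empty chain from being an exception. *)
Theorem Hahn_Banach (G0 : set (V * R)) : dominated_graph G0 ->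
  exists Phi : V -> R,
    [/\ forall a x y, W x -> W y -> Phi (a *: x + y) = a * Phi x + Phi y,
        forall x, W x -> Phi x <= p x &
        forall u, G0 u -> Phi u.1 = u.2].
Proof.
move=> G0P.
have [|G [GP Gmax]] := @Zorn_bigcup (V * R)%type [set G | dominated_graph (G `|` G0)].
  move=> F FP Ftot /=.
  have [-> |/set0P F0] := eqVneq F set0; first by rewrite bigcup_set0 set0U.
  rewrite -bigcupUl//; have [X0 FX0] := F0.
  have mono u v : (\bigcup_(i in F) (i `|` G0)) u -> (\bigcup_(i in F) (i `|` G0)) v ->
      exists X, [/\ F X, (X `|` G0) u & (X `|` G0) v].
    move=> [X FX Xu] [Y FY Yv]; have [XY|YX] := Ftot _ _ FX FY.
      by exists Y; split => //; apply: setSU Xu.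
    by exists X; split => //; apply: setSU Yv.
  split.
  - by exists X0 => //; have [] := FP _ FX0.
  - move=> a u v /mono /[apply] -[X [FX Xu Xv]]; exists X => //.
    by have [_ H _] := FP _ FX; exact: H.
  - by move=> u [X FX Xu]; have [_ _] := FP _ FX; exact.
have Gtot x : W x -> exists r, (G `|` G0) (x, r).
  move=> Wx; apply: contrapT => nx.
  have [G' G'P [GG' [r G'r]]] := dominated_graph_extend GP Wx.
  apply: (Gmax G').
    split; first by move=> u Gu; apply: GG'; left.
    by move=> G'G; apply: nx; exists r; left; exact: G'G.
  by rewrite /= setUidl// => u G0u; apply: GG'; right.
pose Phi x := xget 0 [set r | (G `|` G0) (x, r)].
have PhiP x : W x -> (G `|` G0) (x, Phi x).
  by move=> /Gtot[r Gr]; exact: (@xgetPex _ 0 [set r | (G `|` G0) (x, r)]  (ex_intro _ r Gr)).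
have [G00 Glin Gdom] := GP.
exists Phi; split.
- move=> a x y Wx Wy; apply: (@dominated_graph_fun _ (a *: x + y) _ _ GP).
    by apply: PhiP; exact: W_lin.
  by have := Glin a _ _ (PhiP _ Wx) (PhiP _ Wy).
- by move=> x Wx; have [] := Gdom _ (PhiP _ Wx).
- move=> [x r] /= G0x; apply: (@dominated_graph_fun _ x _ _ GP); last by right.
  by apply: PhiP; have [_ _] := G0P; move=> /(_ _ G0x)[].
Qed.

End hahn_banach.

Section sup_of_seminorms.
Context {R : realType} {E : lmodType R} (S : set E) (N : nat -> E -> R).
Context (C : R) (L : E -> R).
Hypothesis S0 : S 0.
Hypothesis S_lin : forall a x y, S x -> S y -> S (a *: x + y).
Hypothesis N_ge0 : forall k f, 0 <= N k f.
Hypothesis N_homog : forall k a f, S f -> N k (a *: f) = `|a| * N k f.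
Hypothesis N_triangle : forall k f g, S f -> S g -> N k (f + g) <= N k f + N k g.
Hypothesis N_vanish : forall f, S f -> N^~ f @ \oo --> 0.
Hypothesis C_ge0 : 0 <= C.
Hypothesis L_lin : forall a f g, S f -> S g -> L (a *: f + g) = a * L f + L g.
Hypothesis L_dom : forall f B, S f -> (forall k, N k f <= B) -> L f <= C * B.

Let W : set (nat -> E) :=
  [set F | (forall k, S (F k)) /\ exists B, forall k, N k (F k) <= B].

Let p (F : nat -> E) : R := C * sup (range (fun k => N k (F k))).

Let p_le F B : (forall k, N k (F k) <= B) -> p F <= C * B.
Proof.
move=> FB; apply: ler_wpM2l => //; apply: sup_le_ub.
  by exists (N 0 (F 0)), 0%N.
by move=> _ [k _ <-].
Qed.

Let N_le F k : W F -> N k (F k) <= sup (range (fun k => N k (F k))).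
Proof.
move=> [_ [B FB]]; apply: ub_le_sup; last by exists k.
by exists B => _ [j _ <-].
Qed.

Let N0 k : N k 0 = 0.
Proof. by have := N_homog k 0 S0; rewrite scaler0 normr0 mul0r. Qed.

Let SZ a x : S x -> S (a *: x).
Proof. by move=> Sx; rewrite -[_ *: _]addr0; exact: S_lin. Qed.

Let W0 : W 0.
Proof. by split => //; exists 0 => j; rewrite N0. Qed.

Let W_lin a x y : W x -> W y -> W (a *: x + y).
Proof.
move=> [Sx [B xB]] [Sy [B' yB']]; split; first by move=> k; exact: S_lin.
exists (`|a| * B + B') => k; apply: (le_trans (N_triangle _ _ _)) => //.
  exact: SZ.
by rewrite N_homog// lerD// ler_wpM2l.
Qed.

Let p_subadd x y : W x -> W y -> p (x + y) <= p x + p y.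
Proof.
move=> Wx Wy; rewrite -mulrDr; apply: p_le => k.
apply: (le_trans (N_triangle _ _ _)); [exact: Wx.1|exact: Wy.1|].
by apply: lerD; exact: N_le.
Qed.

Let p_homog a x : 0 < a -> W x -> p (a *: x) = a * p x.
Proof.
have H b z : 0 < b -> W z -> p (b *: z) <= b * p z.
  move=> b0 Wz; rewrite mulrCA; apply: p_le => k.
  by rewrite N_homog ?gtr0_norm// ?ler_pM2l//; [exact: N_le|exact: Wz.1].
move=> a0 Wx; apply/eqP; rewrite eq_le H//=.
rewrite -ler_pdivlMl//; have := H a^-1 (a *: x); rewrite scalerA mulVf ?gt_eqF//.
rewrite scale1r invr_gt0; apply => //.
by rewrite -[_ *: _]addr0; exact: W_lin.
Qed.

(** A functional bounded by the supremum of seminorms which tend to 0 on each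
    vector is an absolutely convergent sum of functionals bounded by the single
    seminorms. The diagonal embeds [S] in the space of bounded families, [L] is
    extended there, and the k-th functional is the extension applied to the
    families supported at k. The decay of the seminorms says that the truncations
    of a diagonal family converge to it. *)
Lemma sup_seminorm_decomposition : exists (Lam : nat -> E -> R) (c : nat -> R),
  [/\ forall k a f g, S f -> S g -> Lam k (a *: f + g) = a * Lam k f + Lam k g,
      forall k f, S f -> `|Lam k f| <= c k * N k f,
      forall k, 0 <= c k,
      forall n, \sum_(k < n) c k <= C &
      forall f, S f -> series (Lam^~ f) @ \oo --> L f].
Proof.
have diagP : dominated_graph W p [set u | exists2 f, S f & u = (cst f, L f)].
  split.
  - exists 0 => //; congr pair; have := @L_lin (-1) _ _ S0 S0.
    by rewrite scaler0 addr0 mulN1r addNr.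
  - move=> a _ _ [f Sf ->] [g Sg ->]; exists (a *: f + g); first exact: S_lin.
    by rewrite /= L_lin//; congr pair; apply/funext.
  - move=> _ [f Sf ->] /=.
    have Wf : W (cst f).
      split => //; have /N_vanish/cvgP/cvg_seq_bounded[M [_ /(_ (M + 1))]] := Sf.
      rewrite ltrDl ltr01 => /(_ isT) HM; exists (M + 1) => k.
      by apply: le_trans (HM k I); rewrite /= ler_norm.
    by split => //; apply: L_dom => // k; exact: (N_le k Wf).
have [Phi [Phi_lin Phi_le Phi_ext]] := Hahn_Banach W0 W_lin p_subadd p_homog diagP.
pose dl (k : nat) f : nat -> E := fun j => if j == k then f else 0.
have N_dl k f j : N j (dl k f j) <= N k f.
  by rewrite /dl; case: eqP => [->//|_]; rewrite N0.
have Wdl k f : S f -> W (dl k f).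
  move=> Sf; split; first by move=> j; rewrite /dl; case: ifP.
  by exists (N k f).
pose Lam k f := Phi (dl k f).
have Lam_lin k a f g : S f -> S g -> Lam k (a *: f + g) = a * Lam k f + Lam k g.
  move=> Sf Sg; rewrite /Lam -Phi_lin; [|exact: Wdl..].
  congr Phi; apply/funext => j; rewrite /dl.
  change ((if j == k then a *: f + g else 0) =
    a *: (if j == k then f else 0) + (if j == k then g else 0)).
  by case: ifP => // _; rewrite scaler0 addr0.
have Lam0 k : Lam k 0 = 0.
  have := Lam_lin k (-1) _ _ S0 S0.
  by rewrite scaler0 addr0 mulN1r addNr.
have LamZ k a f : S f -> Lam k (a *: f) = a * Lam k f.
  by move=> Sf; have := Lam_lin k a _ _ Sf S0; rewrite !addr0 Lam0 addr0.
have Lam_le k f : S f -> Lam k f <= C * N k f.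
  by move=> Sf; apply: (le_trans (Phi_le _ (Wdl k f Sf))); apply: p_le => j; exact: N_dl.
pose U k := [set Lam k f | f in [set f | S f /\ N k f <= 1]].
have U_sup k : has_sup (U k).
  split; first by exists (Lam k 0), 0 => //; split => //; rewrite N0.
  exists C => _ [f [Sf fk] <-]; apply: (le_trans (Lam_le _ _ Sf)).
  by rewrite -[leRHS]mulr1 ler_wpM2l.
pose c k := sup (U k).
have c_ge0 k : 0 <= c k.
  apply: (ub_le_sup (U_sup k).2); exists 0; last exact: Lam0.
  by split => //; rewrite N0.
have Lam_c k f : S f -> Lam k f <= c k * N k f.
  move=> Sf; have [Nf0|Nf0] := eqVneq (N k f) 0.
    by apply: (le_trans (Lam_le _ _ Sf)); rewrite Nf0 !mulr0.
  have Nf : 0 < N k f by rewrite lt_neqAle eq_sym Nf0 N_ge0.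
  rewrite -ler_pdivrMr// mulrC -LamZ//; apply: (ub_le_sup (U_sup k).2).
  eexists; last reflexivity.
  by split; [exact: SZ|rewrite N_homog// ger0_norm ?invr_ge0// mulVf].
(* On finitely supported families the extension is the sum of its components. *)
have trunc n F : (forall k, S (F k)) ->
    Phi (fun j => if (j < n)%N then F j else 0) = \sum_(k < n) Lam k (F k) /\
    W (fun j => if (j < n)%N then F j else 0).
  move=> SF; elim: n => [|n [IH IW]].
    rewrite big_ord0 (_ : (fun _ => _) = 0); last by apply/funext.
    split => //; have := Phi_lin (-1) _ _ W0 W0.
    by rewrite scaler0 addr0 mulN1r addNr.
  have -> : (fun j => if (j < n.+1)%N then F j else 0) =
      1 *: dl n (F n) + (fun j => if (j < n)%N then F j else 0).
    apply/funext => j.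
    change ((if (j < n.+1)%N then F j else 0) =
      1 *: (if j == n then F n else 0) + (if (j < n)%N then F j else 0)).
    rewrite scale1r ltnS; case: ltngtP => [jn|jn|->]; rewrite ?add0r ?addr0//.
  have Wd := Wdl n _ (SF n).
  split; last exact: W_lin.
  by rewrite Phi_lin// mul1r IH big_ord_recr/= addrC.
exists Lam, c; split => //.
- move=> k f Sf; rewrite ler_norml Lam_c// andbT lerNl.
  rewrite -mulN1r -LamZ// (le_trans (Lam_c _ _ (SZ _ Sf)))//.
  by rewrite N_homog// normrN1 mul1r.
- move=> n; apply/ler_addgt0Pr => e e0.
  (* A family of almost norming vectors, one for each of the n components, has
     norm at most 1, so that the n suprema add up to at most C + e. *)
  have en0 : 0 < e / n.+1%:R by rewrite divr_gt0.
  have ex k : exists f, [/\ S f, N k f <= 1 & c k - e / n.+1%:R < Lam k f].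
    by have [_ [f [Sf fk] <-] H] := sup_adherent en0 (U_sup k); exists f.
  have [F FP] := choice ex.
  have SF k : S (F k) by have [] := FP k.
  have [tr Wtr] := trunc n F SF.
  apply: (@le_trans _ _ (\sum_(k < n) (Lam k (F k) + e / n.+1%:R))).
    by apply: ler_sum => k _; rewrite -lerBlDr ltW//; have [] := FP k.
  rewrite big_split/= -tr sumr_const card_ord lerD//.
    apply: (le_trans (Phi_le _ Wtr)); rewrite -[leRHS]mulr1; apply: p_le => k.
    by case: ifP => _; [have [] := FP k|rewrite N0].
  rewrite -[leLHS]mulr_natr mulrAC ler_pdivrMr// ler_pM2l// ler_nat.
  exact: leqnSn.
- move=> f Sf; apply/cvgrPdist_le => e e0.
  have eC : 0 < e / (C + 1) by rewrite divr_gt0// ltr_wpDl.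
  have /cvgr0Pnorm_le/(_ _ eC)[n0 _ Hn0] := N_vanish Sf.
  exists n0 => // n /= n0n.
  have tail g : S g -> (forall k, (n <= k)%N -> N k g <= e / (C + 1)) ->
      L g - \sum_(k < n) Lam k g <= e.
    move=> Sg gk; have [tr Wtr] := trunc n (cst g) (fun=> Sg).
    have Lg : Phi (cst g) = L g by apply: (Phi_ext (cst g, L g)); exists g.
    have [_ _ /(_ (cst g, L g)) []] := diagP; first by exists g.
    move=> /= Wg _.
    rewrite -Lg -tr addrC -mulN1r -Phi_lin//.
    apply: le_trans (Phi_le _ _) _; first exact: W_lin.
    apply: (@le_trans _ _ (C * (e / (C + 1)))).
      apply: p_le => k.
      change (N k (-1 *: (if (k < n)%N then g else 0) + g) <= e / (C + 1)).
      case: ltnP => kn; first by rewrite scaleN1r addNr N0 ltW.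
      by rewrite scaler0 add0r; exact: gk.
    rewrite mulrCA ger_pMr// ler_pdivrMr ?mul1r ?lerDl//.
    by rewrite ltr_wpDl.
  have fk k : (n <= k)%N -> N k f <= e / (C + 1).
    move=> nk; have := Hn0 k (leq_trans n0n nk); rewrite /= ger0_norm//.
  rewrite /series/= big_mkord ler_norml tail// andbT lerNl opprB.
  have L0 : L 0 = 0.
    by have := @L_lin (-1) _ _ S0 S0; rewrite scaler0 addr0 mulN1r addNr.
  have := tail (-1 *: f) (SZ _ Sf).
  under eq_bigr do rewrite LamZ// mulN1r.
  have := @L_lin (-1) _ _ Sf S0; rewrite addr0 L0 addr0 mulN1r => ->.
  rewrite sumrN opprK; move=> H; rewrite addrC H//.
  move=> k nk.
  by rewrite N_homog// normrN1 mul1r; exact: fk.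
Qed.

End sup_of_seminorms.

(** * Cubes, local norms and simple functions *)

Section cubes.
Context {R : realType} {n : nat}.
Local Notation mu := (lebesgue_Rn R n).
Implicit Types (Q : set (Rn R n)).

Lemma measurable_cube Q : cube Q -> measurable Q.
Proof.
move=> [a [l [l0 ->]]].
rewrite (_ : mkset _ = \bigcap_(i in [set: 'I_n])
   ((fun x : Rn R n => tnth x i) @^-1` `[tnth a i, tnth a i + l]%classic)); last first.
  apply/seteqP; split => x /=; first by move=> H i _ /=; rewrite in_itv; exact: H.
  by move=> H i; have := H i I; rewrite /= in_itv.
apply: fin_bigcap_measurable; first exact: finite_finset.
move=> i _; rewrite -[X in measurable X]setTI.
exact: measurable_tnth.
Qed.

Lemma cube_measure (a : Rn R n) l : 0 <= l ->
  mu [set x | forall i, tnth a i <= tnth x i <= tnth a i + l] = (l ^+ n)%:E.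
Proof.
move=> l0; rewrite (@lebesgue_Rn_box _ _ (tnth a) (fun i => tnth a i + l)).
  by under eq_bigr do rewrite addrC addKr; rewrite prodr_const card_ord.
by move=> i; rewrite lerDl.
Qed.

Lemma volume_cube (a : Rn R n) l : 0 <= l ->
  volume [set x : Rn R n | forall i, tnth a i <= tnth x i <= tnth a i + l] = l ^+ n.
Proof. by move=> l0; rewrite /volume cube_measure. Qed.

Lemma volume_gt0 Q : cube Q -> 0 < volume Q.
Proof. by move=> [a [l [l0 ->]]]; rewrite volume_cube ?ltW// exprn_gt0. Qed.

Lemma volumeE Q : cube Q -> (volume Q)%:E = mu Q.
Proof.
by move=> [a [l [l0 ->]]]; rewrite volume_cube ?ltW// cube_measure// ltW.
Qed.

Lemma cube_lty Q : cube Q -> (mu Q < +oo)%E.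
Proof. by move=> /volumeE <-; rewrite ltry. Qed.

End cubes.

Lemma hoelder_conjugate_sum (R : realFieldType) (q : R) :
  1 < q -> q^-1 + (q / (q - 1))^-1 = 1.
Proof.
move=> q1; have q0 : 0 < q by exact: lt_trans q1.
by rewrite invf_div mulrBl mulfV ?gt_eqF// mul1r addrC subrK.
Qed.

Lemma hoelder_conjugate_fin (R : realType) (q : R) :
  1 < q -> hoelder_conjugate q%:E = (q / (q - 1))%:E.
Proof.
move=> q1; have q0 : 0 < q by exact: lt_trans q1.
have q'0 : 0 < q / (q - 1) by rewrite divr_gt0// subr_gt0.
apply/esym/hoelder_conjugateP; first exact: ltNyr.
  by rewrite gt_eqF// lte_fin.
by rewrite !inver !gt_eqF//= -EFinD hoelder_conjugate_sum.
Qed.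

Section Lnorm_on.
Context {R : realType} {n : nat}.
Local Notation mu := (lebesgue_Rn R n).
Implicit Types (Q A : set (Rn R n)) (f g : Rn R n -> R) (r : R).

Lemma measurable_fun_restrict Q f : measurable Q -> measurable_fun setT f ->
  measurable_fun setT (f \_ Q).
Proof.
move=> mQ mf; apply/(measurable_restrictT f mQ).
exact: measurable_funTS.
Qed.

Lemma Lnorm_on_ge0 (r : \bar R) Q f : (0 <= Lnorm_on r Q f)%E.
Proof. exact: Lnorm_ge0. Qed.

Lemma Lnorm_onE r Q f : 0 < r ->
  Lnorm_on r%:E Q f = ((\int[mu]_(x in Q) (`|f x| `^ r)%:E) `^ r^-1)%E.
Proof.
move=> r0; rewrite /Lnorm_on unlock; congr (_ `^ _)%E.
rewrite [RHS]integral_mkcond; apply: eq_integral => x _ /=.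
rewrite !patchE; case: ifP => // _.
by rewrite normr0 powR0// gt_eqF.
Qed.

Lemma Lnorm_on_poweR r Q f : 0 < r ->
  (Lnorm_on r%:E Q f `^ r = \int[mu]_(x in Q) (`|f x| `^ r)%:E)%E.
Proof.
move=> r0; rewrite Lnorm_onE// -poweRrM mulVf ?gt_eqF// poweRe1//.
by apply: integral_ge0 => x _; rewrite lee_fin powR_ge0.
Qed.

Lemma ge0_le_poweR (x y : \bar R) r : 0 <= r -> (0 <= x)%E -> (x <= y)%E ->
  (x `^ r <= y `^ r)%E.
Proof.
move=> r0 x0 xy; apply: gt0_ler_poweR => //; rewrite in_itv/= ?leey ?x0//.
by rewrite (le_trans x0).
Qed.

Lemma Lnorm_on_le r Q f B : 0 < r -> 0 <= B ->
  ((Lnorm_on r%:E Q f <= B%:E) = (\int[mu]_(x in Q) (`|f x| `^ r)%:E <= (B `^ r)%:E))%E.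
Proof.
move=> r0 B0; rewrite -Lnorm_on_poweR// -poweR_EFin; apply/idP/idP => [|H].
  by apply: ge0_le_poweR; [exact: ltW|exact: Lnorm_on_ge0].
have : ((Lnorm_on r%:E Q f `^ r) `^ r^-1 <= (B%:E `^ r) `^ r^-1)%E.
  by apply: ge0_le_poweR => //; [rewrite invr_ge0 ltW|exact: poweR_ge0].
by rewrite -!poweRrM mulfV ?gt_eqF// !poweRe1// Lnorm_on_ge0.
Qed.

Lemma Lnorm_on_triangle r Q f g : 1 <= r -> measurable Q ->
    measurable_fun setT f -> measurable_fun setT g ->
  (Lnorm_on r%:E Q (fun x => f x + g x)%R <= Lnorm_on r%:E Q f + Lnorm_on r%:E Q g)%E.
Proof.
move=> r1 mQ mf mg.
have := @minkowski_EFin _ _ _ mu _ _ r (measurable_fun_restrict mQ mf)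
  (measurable_fun_restrict mQ mg) r1.
apply: le_trans; rewrite le_eqVlt /Lnorm_on; apply/orP; left; apply/eqP; congr Lnorm.
by apply/funext => x /=; rewrite !patchE; case: ifP; rewrite ?addr0.
Qed.

Lemma measurable_powR_norm r f (D : set (Rn R n)) : measurable_fun setT f ->
  measurable_fun D (EFin \o (fun x => `|f x| `^ r)).
Proof.
move=> mf; apply/measurable_EFinP/measurable_funTS.
apply: (@measurableT_comp _ _ _ _ _ _ (@powR R ^~ r)) => //.
exact: measurableT_comp.
Qed.

Lemma Lnorm_onZ r Q (a : R) f : 0 < r -> measurable Q -> measurable_fun setT f ->
  (Lnorm_on r%:E Q (fun x => a * f x)%R = `|a|%:E * Lnorm_on r%:E Q f)%E.
Proof.
move=> r0 mQ mf; rewrite !Lnorm_onE//.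
under eq_integral do rewrite normrM powRM// EFinM.
rewrite ge0_integralZl ?lee_fin ?powR_ge0//; last exact: measurable_powR_norm.
rewrite poweRM ?lee_fin ?powR_ge0//.
  by rewrite poweR_EFin -powRrM mulfV ?gt_eqF// powRr1.
by apply: integral_ge0 => x _; rewrite lee_fin powR_ge0.
Qed.

Lemma le_Lnorm_on r Q Q' f g : 0 < r -> measurable Q -> measurable Q' ->
    measurable_fun setT f -> measurable_fun setT g ->
    Q `<=` Q' -> (forall x, Q x -> `|f x| <= `|g x|) ->
  (Lnorm_on r%:E Q f <= Lnorm_on r%:E Q' g)%E.
Proof.
move=> r0 mQ mQ' mf mg QQ' fg; rewrite !Lnorm_onE//.
have ge0 h D : (0 <= \int[mu]_(x in D) (`|h x| `^ r)%:E)%E.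
  by apply: integral_ge0 => x _; rewrite lee_fin powR_ge0.
apply: ge0_le_poweR => //; first by rewrite invr_ge0 ltW.
apply: (@le_trans _ _ (\int[mu]_(x in Q) (`|g x| `^ r)%:E)%E).
  apply: ge0_le_integral => //.
  - exact: measurable_powR_norm.
  - exact: measurable_powR_norm.
  - by move=> x Qx; rewrite lee_fin ge0_ler_powR ?nnegrE ?fg// ltW.
by apply: ge0_subset_integral => //; exact: measurable_powR_norm.
Qed.

Lemma Lnorm_on_indic r Q A : 0 < r -> measurable Q -> measurable A ->
  Lnorm_on r%:E Q \1_A = (mu (A `&` Q) `^ r^-1)%E.
Proof.
move=> r0 mQ mA; rewrite Lnorm_onE//.
under eq_integral.
  move=> x _; rewrite (_ : (_ `^ _) = \1_A x); last first.
    by rewrite indicE; case: (x \in A); rewrite ?normr1 ?powR1// normr0 powR0// gt_eqF.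
  over.
by rewrite integral_indic.
Qed.

End Lnorm_on.

Section finite_simple.
Context {R : realType} {n : nat}.
Local Notation mu := (lebesgue_Rn R n).
Implicit Types (Q A : set (Rn R n)) (f g : Rn R n -> R) (r : R).

Lemma finite_simple0 : @finite_simple R n (cst 0).
Proof.
exists 0%N, (fun=> 0), (fun=> set0); split; first by case.
by apply/funext => x; rewrite big_ord0.
Qed.

Lemma finite_simple_indic A : measurable A -> (mu A < +oo)%E -> finite_simple \1_A.
Proof.
move=> mA Aoo; exists 1%N, (fun=> 1), (fun=> A); split => //.
by apply/funext => x; rewrite big_ord1 mul1r.
Qed.

Lemma finite_simple_lin a f g : finite_simple f -> finite_simple g ->
  finite_simple (fun x => a * f x + g x).
Proof.
move=> [m [c [A [AP ->]]]] [m' [c' [A' [A'P ->]]]].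
exists (m + m')%N,
  (fun i : 'I_(m + m') =>
     match fintype.split i with inl j => a * c j | inr j => c' j end),
  (fun i : 'I_(m + m') =>
     match fintype.split i with inl j => A j | inr j => A' j end); split.
  by move=> i; case: (fintype.split i).
apply/funext => x; rewrite big_split_ord/= mulr_sumr; congr (_ + _).
  by apply: eq_bigr => i _; rewrite (unsplitK (inl i)) mulrA.
by apply: eq_bigr => i _; rewrite (unsplitK (inr i)).
Qed.

(** Simple functions arise from 0 by adding multiples of indicators of sets of
    finite measure, which reduces linear statements about them to indicators. *)
Lemma finite_simple_ind (P : (Rn R n -> R) -> Prop) :
  P (cst 0) ->
  (forall a A f, measurable A -> (mu A < +oo)%E -> finite_simple f -> P f ->
    P (fun x => a * \1_A x + f x)) ->
  forall f, finite_simple f -> P f.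
Proof.
move=> P0 PS f [m [c [A [AP ->]]]]; elim: m c A AP => [|m IH] c A AP.
  by rewrite (_ : (fun _ => _) = cst 0)//; apply/funext => x; rewrite big_ord0.
rewrite (_ : (fun x => _) = (fun x => c ord0 * \1_(A ord0) x +
    (fun x => \sum_(i < m) c (lift ord0 i) * \1_(A (lift ord0 i)) x) x)).
  have [mA Aoo] := AP ord0; apply: PS => //; last by apply: IH => i; exact: AP.
  by exists m, (c \o lift ord0), (A \o lift ord0); split => // i; exact: AP.
by apply/funext => x; rewrite big_ord_recl.
Qed.

Lemma finite_simple_restrict f D : finite_simple f -> measurable D ->
  finite_simple (f \_ D).
Proof.
move=> [m [c [A [AP ->]]]] mD; exists m, c, (fun i => A i `&` D); split.
  move=> i; have [mA Aoo] := AP i; split; first exact: measurableI.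
  by apply: le_lt_trans Aoo; apply: le_measure; rewrite ?inE//; exact: measurableI.
apply/funext => x; rewrite patchE; case: ifPn => xD.
  by apply: eq_bigr => i _; rewrite !indicE in_setI xD andbT.
by rewrite big1// => i _; rewrite indicE in_setI (negbTE xD) andbF mulr0.
Qed.

Lemma finite_simple_measurable f : finite_simple f -> measurable_fun setT f.
Proof.
move: f; apply: finite_simple_ind => // a A f mA _ _ mf.
by apply: measurable_funD => //; apply: measurable_funM => //.
Qed.

Lemma finite_simple_Lnorm_on r Q f : 1 <= r -> measurable Q -> finite_simple f ->
  (Lnorm_on r%:E Q f < +oo)%E.
Proof.
move=> r1 mQ; have r0 : 0 < r by rewrite (lt_le_trans _ r1).
move: f; apply: finite_simple_ind => [|a A f mA Aoo sf ih].
  rewrite Lnorm_onE//; under eq_integral do rewrite normr0 powR0 ?gt_eqF//.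
  by rewrite integral0 poweR0r// invr_neq0// gt_eqF.
apply: (le_lt_trans (Lnorm_on_triangle r1 mQ _ _)).
- by apply: measurable_funM => //.
- exact: finite_simple_measurable.
rewrite lte_add_pinfty// Lnorm_onZ// Lnorm_on_indic// lte_mul_pinfty//.
apply: poweR_lty; apply: le_lt_trans Aoo; apply: le_measure; rewrite ?inE//.
exact: measurableI.
Qed.

End finite_simple.

Section Lseminorm.
Context {R : realType} {n : nat}.
Local Notation mu := (lebesgue_Rn R n).
Local Notation T := (Rn R n).
Context (q : R) (q1 : 1 < q).
Implicit Types (Q A : set T) (f g : T -> R).

Let q0 : 0 < q. Proof. exact: lt_trans q1. Qed.

Definition Lseminorm Q f : R := fine (Lnorm_on q%:E Q f).

Lemma Lseminorm_ge0 Q f : 0 <= Lseminorm Q f.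
Proof. by rewrite fine_ge0// Lnorm_on_ge0. Qed.

Lemma LseminormK Q f : measurable Q -> finite_simple f ->
  (Lseminorm Q f)%:E = Lnorm_on q%:E Q f.
Proof.
move=> mQ sf; rewrite fineK// ge0_fin_numE ?Lnorm_on_ge0//.
by rewrite finite_simple_Lnorm_on ?ltW.
Qed.

Lemma LseminormZ Q a f : measurable Q -> finite_simple f ->
  Lseminorm Q (fun x => a * f x) = `|a| * Lseminorm Q f.
Proof.
move=> mQ sf; rewrite {1}/Lseminorm Lnorm_onZ//; last exact: finite_simple_measurable.
by rewrite -LseminormK.
Qed.

Lemma LseminormD Q f g : measurable Q -> finite_simple f -> finite_simple g ->
  Lseminorm Q (fun x => f x + g x) <= Lseminorm Q f + Lseminorm Q g.
Proof.
move=> mQ sf sg.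
have sfg : finite_simple (fun x => f x + g x).
  by have := finite_simple_lin 1 sf sg; under eq_fun do rewrite mul1r.
rewrite -lee_fin EFinD !LseminormK//.
by apply: Lnorm_on_triangle => //; [exact: ltW|exact: finite_simple_measurable..].
Qed.

Lemma le_Lseminorm Q Q' f g : measurable Q -> measurable Q' ->
    finite_simple f -> finite_simple g ->
    Q `<=` Q' -> (forall x, Q x -> `|f x| <= `|g x|) ->
  Lseminorm Q f <= Lseminorm Q' g.
Proof.
move=> mQ mQ' sf sg QQ' fg; rewrite -lee_fin !LseminormK//.
by apply: le_Lnorm_on => //; exact: finite_simple_measurable.
Qed.

Lemma Lseminorm_restrict Q f : Lseminorm setT (f \_ Q) = Lseminorm Q f.
Proof.
rewrite /Lseminorm /Lnorm_on; congr (fine (Lnorm _ _ _)).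
by apply/funext => x /=; rewrite patchE in_setT.
Qed.

Lemma finite_simpleZ a f : finite_simple f -> finite_simple (fun x => a * f x).
Proof.
by move=> sf; have := finite_simple_lin a sf (@finite_simple0 R n);
  under eq_fun do rewrite addr0.
Qed.

(** Subadditivity reduces the decay of the seminorms to indicators. *)
Lemma weighted_Lseminorm_cvg0 (w : nat -> R) (Q : nat -> set T) :
    (forall k, 0 <= w k) -> (forall k, measurable (Q k)) ->
    (forall A, measurable A -> (mu A < +oo)%E ->
      (fun k => w k * Lseminorm (Q k) \1_A) @ \oo --> 0) ->
  forall f, finite_simple f -> (fun k => w k * Lseminorm (Q k) f) @ \oo --> 0.
Proof.
move=> w0 mQ QA; apply: finite_simple_ind => [|a A f mA Aoo sf ih].
  apply: cvg_near_cst; apply: nearW => k.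
  have := LseminormZ 0 (mQ k) (@finite_simple0 R n).
  by rewrite normr0 mul0r; under eq_fun do rewrite mul0r; move=> ->; rewrite mulr0.
have sA := finite_simple_indic mA Aoo.
apply: (@squeeze_cvgr _ _ _ _ (cst 0)
  (fun k => `|a| * (w k * Lseminorm (Q k) \1_A) + w k * Lseminorm (Q k) f)).
- apply: nearW => k /=; rewrite mulr_ge0 ?Lseminorm_ge0//=.
  rewrite mulrCA -mulrDr ler_wpM2l// -LseminormZ//.
  by apply: LseminormD => //; exact: finite_simpleZ.
- exact: cvg_cst.
- rewrite -[X in _ --> X]addr0 -[X in X + _](mulr0 `|a|).
  by apply: cvgD => //; apply: cvgMl_tmp; exact: QA.
Qed.

End Lseminorm.

(** * Duality of L^q on a set of finite measure *)

Lemma cvg_poweR0 (R : realType) (x : nat -> \bar R) (r : R) : 0 < r ->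
  (forall k, (0 <= x k)%E) -> x @ \oo --> 0%E -> (fun k => x k `^ r)%E @ \oo --> 0%E.
Proof.
move=> r0 x0 /fine_cvgP[xfin xcvg]; apply/fine_cvgP; split.
  by apply: filterS xfin => k; exact: fin_num_poweR.
apply/cvgr0Pnorm_le => e e0.
have er0 : 0 < e `^ r^-1 by rewrite powR_gt0.
have /cvgr0Pnorm_le/(_ _ er0) := xcvg.
apply: filterS => k /=; rewrite fine_poweR !ger0_norm ?powR_ge0 ?fine_ge0// => H.
have -> : e = (e `^ r^-1) `^ r by rewrite -powRrM mulVf ?gt_eqF// powRr1// ltW.
by rewrite ge0_ler_powR ?nnegrE ?powR_ge0 ?fine_ge0// ltW.
Qed.

Section finite_simple_comp.
Context {R : realType} {n : nat}.
Local Notation mu := (lebesgue_Rn R n).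
Local Notation T := (Rn R n).
Import finmap HBNNSimple.

Lemma finite_simple_sum (I : Type) (s : seq I) (a : I -> R) (A : I -> set T) :
  (forall i, measurable (A i)) -> (forall i, (mu (A i) < +oo)%E) ->
  finite_simple (fun x => \sum_(i <- s) a i * \1_(A i) x).
Proof.
move=> mA Aoo; elim: s => [|i s ih].
  rewrite (_ : (fun _ => _) = cst 0); first exact: finite_simple0.
  by apply/funext => x; rewrite big_nil.
rewrite (_ : (fun _ => _) =
    (fun x => a i * \1_(A i) x + (\sum_(i <- s) a i * \1_(A i) x))).
  by apply: finite_simple_lin => //; exact: finite_simple_indic.
by apply/funext => x; rewrite big_cons.
Qed.

Lemma finite_simple_comp (phi : {nnsfun T >-> R}) (k : R -> R) (D : set T) :
  measurable D -> (mu D < +oo)%E -> (forall x, ~ D x -> k (phi x) = 0) ->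
  finite_simple (k \o phi).
Proof.
move=> mD Doo kD.
rewrite (_ : _ \o _ = (fun x => \sum_(y <- fset_set (range phi))
    k y * \1_(phi @^-1` [set y] `&` D) x)).
  apply: finite_simple_sum => y; first by apply: measurableI => //.
  by apply: le_lt_trans Doo; exact: measureIr.
apply/funext => x /=.
have [xD|nxD] := pselect (D x); last first.
  rewrite kD// big1// => y _; rewrite indicE memNset ?mulr0//.
  by move=> -[].
rewrite (bigD1_seq (phi x))/= ?fset_uniq//; last first.
  by rewrite in_fset_set//; apply: mem_set; exists x.
rewrite indicE mem_set// mulr1 big1 ?addr0// => y yx.
by rewrite indicE memNset ?mulr0// => -[/= xy _]; rewrite xy eqxx in yx.
Qed.

End finite_simple_comp.

Section riesz.
Context {R : realType} {n : nat}.
Local Notation mu := (lebesgue_Rn R n).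
Local Notation T := (Rn R n).

Import HBNNSimple.

Variables (D : set T) (mD : measurable D) (Doo : (mu D < +oo)%E).
Variables (q : R) (q1 : 1 < q) (Lam : (T -> R) -> R) (c : R) (c0 : 0 <= c).
Hypothesis Lam_lin : forall a f g, finite_simple f -> finite_simple g ->
  Lam (fun x => a * f x + g x) = a * Lam f + Lam g.
Hypothesis Lam_le : forall f, finite_simple f ->
  `|Lam f| <= c * fine (Lnorm_on q%:E D f).

Let q0 : 0 < q. Proof. exact: lt_trans q1. Qed.

Let Lam_ext f g : finite_simple f -> finite_simple g ->
  (forall x, D x -> f x = g x) -> Lam f = Lam g.
Proof.
move=> sf sg fg; apply/eqP; rewrite -subr_eq0 -normr_le0.
have -> : Lam f - Lam g = Lam (fun x => -1 * g x + f x).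
  by rewrite Lam_lin// mulN1r addrC.
apply: (le_trans (Lam_le _)); first exact: finite_simple_lin.
rewrite Lnorm_onE// integral_mkcond (eq_integral (cst 0%E)).
  by rewrite integral0 poweR0r ?invr_neq0// ?gt_eqF// mulr0.
move=> x _; rewrite patchE; case: ifPn => //; rewrite inE => Dx.
by rewrite fg// mulN1r addNr normr0 powR0// gt_eqF.
Qed.

(* The candidate for the measure with density representing [Lam], set to 0 on
   non-measurable sets so that it is a total set function. *)
Let nu (A : set T) : \bar R := if pselect (measurable A) then (Lam \1_(A `&` D))%:E else 0%E.

Let fsD A : measurable A -> @finite_simple R n \1_(A `&` D).
Proof.
move=> mA; apply: finite_simple_indic; first exact: measurableI.
by apply: le_lt_trans Doo; exact: measureIr.
Qed.

Let nuE A : measurable A -> nu A = (Lam \1_(A `&` D))%:E.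
Proof. by rewrite /nu; case: pselect. Qed.

Let Lam0 : Lam (cst 0) = 0.
Proof.
have := @Lam_lin (-1) _ _ (@finite_simple0 R n) (@finite_simple0 R n).
rewrite mulN1r addNr; apply: etrans; congr Lam; apply/funext => x.
by rewrite /= mulr0 addr0.
Qed.

Let nu0 : nu set0 = 0%E.
Proof.
by rewrite nuE// set0I indic0 Lam0.
Qed.

Let nu_fin A : measurable A -> nu A \is a fin_num.
Proof. by move=> mA; rewrite nuE. Qed.

Let nu_le A : measurable A -> (`|nu A| <= c%:E * mu (A `&` D) `^ q^-1)%E.
Proof.
move=> mA; rewrite nuE// abse_EFin.
have AD : (mu (A `&` D `&` D) < +oo)%E.
  apply: le_lt_trans Doo; apply: measureIr => //; exact: measurableI.
apply: (@le_trans _ _ (c * fine (Lnorm_on q%:E D \1_(A `&` D)))%:E).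
  by rewrite lee_fin; exact/Lam_le/fsD.
rewrite Lnorm_on_indic//; last exact: measurableI.
rewrite EFinM fineK; first by rewrite -setIA setIid.
by rewrite fin_num_poweR// ge0_fin_numE.
Qed.

Let nuU A B : measurable A -> measurable B -> A `&` B = set0 ->
  (nu (A `|` B) = nu A + nu B)%E.
Proof.
move=> mA mB AB; rewrite !nuE//; last exact: measurableU.
rewrite -EFinD -[X in X + _]mul1r -Lam_lin; [|exact: fsD..].
congr (Lam _)%:E; apply/funext => x; rewrite !indicE !in_setI in_setU mul1r.
case: (boolP (x \in A)) => xA; case: (boolP (x \in B)) => xB; rewrite ?orbb ?add0r ?addr0//=.
have : (A `&` B) x by split; exact/set_mem.
by rewrite AB.
Qed.

(* The bound by the L^q-norm makes [nu] of the tails of a disjoint union tend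
   to 0. *)
Let nu_sigma_additive : semi_sigma_additive nu.
Proof.
move=> F mF tF mUF.
pose G m := \bigcup_(k in [set k | (m <= k)%N]) F k.
have mG m : measurable (G m) by apply: bigcup_measurable.
have GS m : G m = F m `|` G m.+1.
  apply/seteqP; split => x.
    move=> [k /= mk Fk]; move: mk; rewrite leq_eqVlt => /predU1P[->|mk]; first by left.
    by right; exists k.
  by move=> [Fx|[k /= mk Fk]]; [exists m => /=|exists k => //=; exact: ltnW].
have FG m : F m `&` G m.+1 = set0.
  rewrite -subset0 => x [Fx [k /= mk Fkx]].
  have := @tF m k Logic.I Logic.I; rewrite (_ : (m = k) = False) => [|].
    by apply; exists x.
  by apply/propext; split => // mk'; rewrite mk' ltnn in mk.
have nuG m : (nu (\bigcup_k F k) = \sum_(0 <= i < m) nu (F i) + nu (G m))%E.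
  elim: m => [|m ih].
    rewrite big_geq// add0e; congr nu; apply/seteqP; split => x [k _ Fk]; exists k => //.
  by rewrite ih big_nat_recr//= GS nuU// ?addeA.
have GD0 : (fun m => mu (G m `&` D)) @ \oo --> 0%E.
  rewrite -(measure0 mu) (_ : set0 = \bigcap_m (G m `&` D)); last first.
    apply/esym; rewrite -subset0 => x H.
    have [[k _ Fk] _] := H 0%N Logic.I.
    have [[j /= kj Fj] _] := H k.+1 Logic.I.
    suff : (F k `&` G k.+1) x by rewrite FG.
    by split => //; exists j.
  apply: (@nonincreasing_cvg_mu _ _ _ mu (fun m => G m `&` D)).
  - by apply: le_lt_trans Doo; exact: measureIr.
  - by move=> i; exact: measurableI.
  - by apply: bigcap_measurable => // i _; exact: measurableI.
  - move=> i j ij; apply/subsetPset; apply: setSI => x [k /= jk Fk].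
    by exists k => //=; exact: leq_trans jk.
have nuG0 : (fun m => nu (G m)) @ \oo --> 0%E.
  apply/cvg_abse0P; apply: (@squeeze_cvge _ _ _ _ (cst 0%E) _
      (fun m => c%:E * mu (G m `&` D) `^ q^-1)%E).
  - by apply: nearW => m; rewrite /= abse_ge0 nu_le.
  - exact: cvg_cst.
  - rewrite -(mule0 c%:E); apply: cvgeZl => //.
    by apply: cvg_poweR0 => //; rewrite ?invr_gt0.
rewrite (_ : (fun _ => _) = (fun m => nu (\bigcup_k F k) - nu (G m)))%E; last first.
  by apply/funext => m; rewrite (nuG m) addeK// nu_fin.
rewrite -[X in _ --> X]sube0; apply: cvgeB => //; last exact: cvg_cst.
by rewrite fin_num_adde_defl.
Qed.

HB.instance Definition _ := isCharge.Build _ _ _ nu nu0 nu_fin nu_sigma_additive.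

Let nu_mu : nu `<< mu.
Proof.
apply/null_content_dominatesP => A mA A0; apply/eqP; rewrite -abse_eq0 eq_le abse_ge0 andbT.
apply: (le_trans (nu_le mA)).
suff -> : mu (A `&` D) = 0%E by rewrite poweR0r ?invr_neq0 ?gt_eqF// mule0.
apply/eqP; rewrite eq_le measure_ge0 andbT -A0.
exact: measureIl.
Qed.

Let g : T -> R := (fine \o (Radon_Nikodym nu mu)) \_ D.

Let mg : measurable_fun setT g.
Proof.
apply: measurable_fun_restrict => //; apply: measurableT_comp => //.
Qed.

(** The density comes from the Radon-Nikodym theorem, applied to the charge that
    sends A to the value of the functional at the indicator of A in D. Its norm is
    estimated by testing against s = sgn(g) phi^(1/q) for simple functions phi
    increasing to |g|^q': then phi <= s g and |s|^q = phi, so that the integral I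
    of phi satisfies I <= c I^(1/q). *)
Lemma riesz_density : exists g : T -> R, [/\ measurable_fun setT g,
  forall x, ~ D x -> g x = 0,
  forall f, finite_simple f -> mu.-integrable setT (EFin \o (f \* g)) /\
      Lam f = \int[mu]_x (f x * g x) &
  (Lnorm_on (hoelder_conjugate q%:E) D g <= c%:E)%E].
Proof.
have gD x : ~ D x -> g x = 0 by move=> nDx; rewrite /g patchE memNset.
have gA A : measurable A -> (mu A < +oo)%E ->
    mu.-integrable setT (EFin \o (\1_A \* g)) /\
    Lam \1_A = \int[mu]_x (\1_A x * g x).
  move=> mA Aoo.
  have E x : (\1_A x * g x)%:E = ((Radon_Nikodym nu mu) \_ (A `&` D)) x.
    rewrite /g !patchE indicE in_setI; case: (x \in A); rewrite /= ?mul0r//.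
    by rewrite mul1r; case: ifP => //= _; rewrite fineK// Radon_Nikodym_fin_num.
  split.
    rewrite (_ : EFin \o _ = (Radon_Nikodym nu mu) \_ (A `&` D)); last first.
      by apply/funext => x; exact: E.
    apply/(integrable_mkcond _ (measurableI _ _ mA mD)).
    apply: (integrableS measurableT) => //; first exact: measurableI.
    exact: Radon_Nikodym_integrable.
  have -> : Lam \1_A = Lam \1_(A `&` D).
    apply: Lam_ext => //; [exact: finite_simple_indic|exact: fsD|].
    by move=> x Dx; rewrite !indicE in_setI (mem_set Dx) andbT.
  rewrite /Rintegral; under eq_integral do rewrite E.
  rewrite -integral_mkcond -Radon_Nikodym_integral//; last exact: measurableI.
  change (Lam \1_(A `&` D) = fine (nu (A `&` D))).
  by rewrite nuE; [rewrite -setIA setIid|exact: measurableI].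
have gf f : finite_simple f -> mu.-integrable setT (EFin \o (f \* g)) /\
    Lam f = \int[mu]_x (f x * g x).
  move: f; apply: finite_simple_ind.
    rewrite Lam0; split.
      rewrite (_ : _ \o _ = cst 0%E); last by apply/funext => x; rewrite /= mul0r.
      exact: integrable0.
    by rewrite /Rintegral integral0_eq//= => x _; rewrite mul0r.
  move=> a A f mA Aoo sf [fgi Lf]; have [Agi LA] := gA A mA Aoo.
  have E x : ((a * \1_A x + f x) * g x = a * (\1_A x * g x) + f x * g x)%R.
    by rewrite mulrDl mulrA.
  have agi : mu.-integrable setT (EFin \o (fun x => a * (\1_A x * g x))).
    exact: (integrableZl measurableT a Agi).
  split.
    rewrite (_ : _ \o _ = ((EFin \o (fun x => a * (\1_A x * g x))%R) \+
        (EFin \o (f \* g)%R))%E).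
      exact: integrableD.
    by apply/funext => x; rewrite /= E.
  rewrite Lam_lin//; last exact: finite_simple_indic.
  rewrite LA Lf; under [RHS]eq_Rintegral do rewrite E.
  by rewrite RintegralD// RintegralZl.
exists g; split => //.
pose q' := q / (q - 1).
have q'0 : 0 < q' by rewrite divr_gt0// subr_gt0.
have qq' : q^-1 + q'^-1 = 1 by exact: hoelder_conjugate_sum.
have -> : hoelder_conjugate q%:E = q'%:E by exact: hoelder_conjugate_fin.
rewrite Lnorm_on_le//.
pose u x := (`|g x| `^ q')%:E.
have mu_u : measurable_fun setT u by exact: measurable_powR_norm.
have u0 x : setT x -> (0 <= u x)%E by move=> _; rewrite lee_fin powR_ge0.
pose phi := nnsfun_approx measurableT mu_u.
have phi_u m x : phi m x <= `|g x| `^ q'.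
  rewrite -lee_fin nnsfun_approxE; exact: le_approx.
have phi0 m x : ~ D x -> phi m x = 0.
  move=> /gD gx0; apply/eqP; rewrite eq_le fun_ge0 andbT (le_trans (phi_u m x))//.
  by rewrite gx0 normr0 powR0// gt_eqF.
suff H m : (\int[mu]_(x in D) (phi m x)%:E <= (c `^ q')%:E)%E.
  rewrite (eq_integral (fun x => limn (fun m => (phi m x)%:E))); last first.
    by move=> x _; apply/esym/cvg_lim => //; exact: cvg_nnsfun_approx.
  rewrite monotone_convergence//; last 3 first.
  - by move=> m; apply/measurable_EFinP/measurable_funTS.
  - by move=> m x _; rewrite lee_fin.
  - by move=> x _ m m' mm'; rewrite lee_fin; exact/lefP/nd_nnsfun_approx.
  apply: lime_le; last exact: nearW.
  apply: ereal_nondecreasing_is_cvgn => m m' mm'.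
  apply: ge0_le_integral => //.
  - by move=> x _; rewrite lee_fin.
  - by apply/measurable_EFinP/measurable_funTS.
  - by apply/measurable_EFinP/measurable_funTS.
  - by move=> x _; rewrite lee_fin; exact/lefP/nd_nnsfun_approx.
pose psi x := phi m x `^ q^-1.
have spsi : finite_simple psi.
  apply: (@finite_simple_comp R n (phi m) (fun y => y `^ q^-1) D) => // x nDx.
  by rewrite phi0// powR0// invr_neq0// gt_eqF.
pose P := [set x | 0 <= g x].
have mP : measurable P.
  rewrite (_ : P = g @^-1` `[0, +oo[%classic).
    by rewrite -[X in measurable X]setTI; exact: mg.
  by apply/seteqP; split => x /=; rewrite in_itv/= andbT.
pose s x := -1 * (psi \_ (~` P)) x + (psi \_ P) x.
have ss : finite_simple s.
  by apply: finite_simple_lin; apply: finite_simple_restrict => //; exact: measurableC.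
have sE x : s x = if 0 <= g x then psi x else - psi x.
  rewrite /s !patchE in_setC; have [gx|gx] := boolP (0 <= g x).
    by rewrite (mem_set (gx : P x))/= mulr0 add0r.
  have -> : (x \in P) = false by apply: memNset; exact/negP.
  by rewrite addr0 mulN1r.
have sg x : s x * g x = psi x * `|g x|.
  rewrite sE; case: ifPn => gx; first by rewrite ger0_norm.
  by rewrite ltr0_norm ?mulNr ?mulrN// ltNge.
have snorm x : `|s x| = psi x.
  by rewrite sE; case: ifPn => _; rewrite ?normrN ger0_norm// powR_ge0.
have [sgi Ls] := gf _ ss.
have IE : (Lnorm_on q%:E D s `^ q = \int[mu]_(x in D) (phi m x)%:E)%E.
  rewrite Lnorm_on_poweR//; apply: eq_integral => x _.
  by rewrite snorm /psi -powRrM mulVf ?gt_eqF// powRr1.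
have Ifin : (\int[mu]_(x in D) (phi m x)%:E)%E \is a fin_num.
  rewrite -IE fin_num_poweR// ge0_fin_numE ?Lnorm_on_ge0//.
  by apply: finite_simple_Lnorm_on => //; exact: ltW.
pose i := fine (\int[mu]_(x in D) (phi m x)%:E)%E.
have i0 : 0 <= i by apply: fine_ge0; apply: integral_ge0 => x _; rewrite lee_fin.
have NsE : fine (Lnorm_on q%:E D s) = i `^ q^-1.
  rewrite /i -IE fine_poweR -powRrM mulfV ?gt_eqF// powRr1//.
  by apply: fine_ge0; exact: Lnorm_on_ge0.
(* Here phi = phi^(1/q) phi^(1/q') <= phi^(1/q) |g| is used. *)
have iL : i <= Lam s.
  rewrite Ls /Rintegral -lee_fin !fineK//; last exact: integrable_fin_num.
  rewrite [leLHS]integral_mkcond; apply: ge0_le_integral => //.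
  - by move=> x _; rewrite patchE; case: ifP => // _; rewrite lee_fin.
  - apply/(measurable_restrictT _ mD)/measurable_funTS.
    exact/measurable_EFinP.
  - exact: measurable_int sgi.
  - move=> x _; rewrite sg patchE; case: ifP => _; last first.
      by rewrite lee_fin mulr_ge0// powR_ge0.
    rewrite lee_fin; have [->|px] := eqVneq (phi m x) 0.
      by rewrite mulr_ge0// powR_ge0.
    rewrite -[leLHS]powRr1// -qq' powRD ?px ?implybT//.
    rewrite ler_wpM2l ?powR_ge0//.
    have -> : `|g x| = (`|g x| `^ q') `^ q'^-1.
      by rewrite -powRrM mulfV ?gt_eqF// powRr1.
    by rewrite ge0_ler_powR ?nnegrE ?powR_ge0// invr_ge0 ltW.
have ile : i <= c * i `^ q^-1.
  by apply: (le_trans iL); rewrite -NsE (le_trans (ler_norm _))// Lam_le.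
rewrite -(fineK Ifin) -/i lee_fin.
have [->|ineq0] := eqVneq i 0; first by rewrite powR_ge0.
have igt0 : 0 < i by rewrite lt_neqAle eq_sym ineq0.
have : i `^ q'^-1 <= c.
  rewrite -(@ler_pM2l _ (i `^ q^-1)) ?powR_gt0// -powRD ?ineq0 ?implybT//.
  by rewrite qq' powRr1// mulrC.
move=> /(@ge0_ler_powR _ q'); rewrite !nnegrE powR_ge0 => /(_ (ltW q'0) isT c0).
by rewrite -powRrM mulVf ?gt_eqF// powRr1.
Qed.

End riesz.

(** * Morrey norms and the pairing with blocks *)

Section morrey_norm.
Context {R : realType} {n : nat}.
Local Notation mu := (lebesgue_Rn R n).
Local Notation T := (Rn R n).
Context (p q : R) (q1 : 1 < q) (qp : q <= p).

Let q0 : 0 < q. Proof. exact: lt_trans q1. Qed.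
Let p0 : 0 < p. Proof. exact: lt_le_trans qp. Qed.

Lemma Lnorm_on_le_morrey_norm Q (f : T -> R) : cube Q ->
  ((volume Q `^ (p^-1 - q^-1))%:E * Lnorm_on q%:E Q f <= morrey_norm p q f)%E.
Proof. by move=> cQ; apply: ereal_sup_ubound; exists Q. Qed.

Lemma morrey_norm_le (f : T -> R) B :
  (forall Q, cube Q -> (volume Q `^ (p^-1 - q^-1))%:E * Lnorm_on q%:E Q f <= B)%E ->
  (morrey_norm p q f <= B)%E.
Proof. by move=> H; apply: ge_ereal_sup => _ [Q cQ <-]; exact: H. Qed.

Lemma morrey_norm_ge0 (f : T -> R) : (0 <= morrey_norm p q f)%E.
Proof.
pose o : T := [tuple of nseq n 0].
pose Q : set T := [set x | forall i, tnth o i <= tnth x i <= tnth o i + 1].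
have cQ : cube Q by exists o, 1.
apply: le_trans (Lnorm_on_le_morrey_norm f cQ).
by rewrite mule_ge0 ?Lnorm_on_ge0// lee_fin powR_ge0.
Qed.

Lemma morrey_norm_lin a (f g : T -> R) :
    measurable_fun setT f -> measurable_fun setT g ->
  (morrey_norm p q (fun x => a * f x + g x)%R <=
    `|a|%:E * morrey_norm p q f + morrey_norm p q g)%E.
Proof.
move=> mf mg; apply: morrey_norm_le => Q cQ; have mQ := measurable_cube cQ.
have maf : measurable_fun setT (fun x => a * f x) by exact: measurable_funM.
apply: (@le_trans _ _ ((volume Q `^ (p^-1 - q^-1))%:E *
   (`|a|%:E * Lnorm_on q%:E Q f + Lnorm_on q%:E Q g))%E).
  rewrite lee_wpmul2l ?lee_fin ?powR_ge0// -Lnorm_onZ//.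
  by apply: Lnorm_on_triangle => //; exact: ltW.
rewrite muleDr//; last by rewrite ge0_adde_def ?inE// ?mule_ge0 ?Lnorm_on_ge0.
apply: leeD; last exact: Lnorm_on_le_morrey_norm.
by rewrite muleCA lee_wpmul2l// Lnorm_on_le_morrey_norm.
Qed.

(** With t the measure of the part of A in Q, the quantity |Q|^(1/p - 1/q) t^(1/q) is
    at most t^(1/p), since t <= |Q| and 1/q - 1/p >= 0. *)
Lemma morrey_norm_indic (A : set T) : measurable A -> (mu A < +oo)%E ->
  (morrey_norm p q \1_A < +oo)%E.
Proof.
move=> mA Aoo; apply: (@le_lt_trans _ _ (mu A `^ p^-1)%E); last exact: poweR_lty.
apply: morrey_norm_le => Q cQ; have mQ := measurable_cube cQ.
rewrite Lnorm_on_indic//.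
have [AQA AQQ] : (mu (A `&` Q) <= mu A)%E /\ (mu (A `&` Q) <= mu Q)%E.
  by split; [exact: measureIl|exact: measureIr].
have AQfin : mu (A `&` Q) \is a fin_num.
  by rewrite ge0_fin_numE// (le_lt_trans AQA).
have : (mu (A `&` Q) `^ p^-1 <= mu A `^ p^-1)%E.
  by apply: ge0_le_poweR => //; rewrite invr_ge0 ltW.
apply: le_trans; move: AQQ; rewrite -(volumeE cQ) -(fineK AQfin) !poweR_EFin !lee_fin.
have V0 := volume_gt0 cQ; set V := volume Q in V0 *; set t := fine _ => tV.
have [->|tne0] := eqVneq t 0.
  by rewrite !powR0 ?mulr0// invr_neq0// gt_eqF.
have t0 : 0 < t by rewrite lt_neqAle eq_sym tne0 fine_ge0.
have -> : t `^ q^-1 = t `^ (q^-1 - p^-1) * t `^ p^-1.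
  by rewrite -powRD ?tne0 ?implybT// subrK.
rewrite mulrA.
rewrite ler_piMl ?powR_ge0//.
rewrite -[p^-1 - q^-1]opprB powRN ler_pdivrMl ?powR_gt0// mulr1.
have s0 : 0 <= q^-1 - p^-1 by rewrite subr_ge0 lef_pV2 ?posrE.
by apply: ge0_ler_powR => //; rewrite nnegrE ltW.
Qed.

Lemma finite_simple_morrey_norm (f : T -> R) : finite_simple f ->
  (morrey_norm p q f < +oo)%E.
Proof.
move: f; apply: finite_simple_ind.
  apply: le_lt_trans (ltry 0); apply: morrey_norm_le => Q cQ.
  by rewrite Lnorm_onE//; under eq_integral do rewrite normr0 powR0 ?gt_eqF//;
    rewrite integral0 poweR0r ?mule0// invr_neq0// gt_eqF.
move=> a A f mA Aoo sf foo.
apply: le_lt_trans (morrey_norm_lin _ _ (finite_simple_measurable sf)) _ => //.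
by rewrite lte_add_pinfty// lte_mul_pinfty// morrey_norm_indic.
Qed.

Lemma morreyP (f : T -> R) : measurable_fun setT f -> (morrey_norm p q f < +oo)%E ->
  morrey p q f.
Proof.
move=> mf foo; split => //; split => // Q cQ.
have := le_lt_trans (Lnorm_on_le_morrey_norm f cQ) foo.
have w0 : 0 < volume Q `^ (p^-1 - q^-1) by rewrite powR_gt0// volume_gt0.
case E : (Lnorm_on _ _ _) => [r| |]; rewrite ?ltry ?ltNyr//.
by rewrite gt0_muley ?lte_fin.
Qed.

Lemma finite_simple_tilde (f : T -> R) : finite_simple f -> morrey_tilde p q f.
Proof.
move=> sf; split.
  by apply: morreyP; [exact: finite_simple_measurable|exact: finite_simple_morrey_norm].
move=> e e0; exists f => //; apply: (@le_lt_trans _ _ 0%E); last by rewrite lte_fin.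
apply: morrey_norm_le => Q cQ; rewrite Lnorm_onE//.
under eq_integral do rewrite /= subrr normr0 powR0 ?gt_eqF//.
by rewrite integral0 poweR0r ?mule0// invr_neq0// gt_eqF.
Qed.

Lemma tilde_measurable (f : T -> R) : morrey_tilde p q f -> measurable_fun setT f.
Proof. by move=> [[[]]]. Qed.

Lemma tilde_morrey_norm (f : T -> R) : morrey_tilde p q f -> (morrey_norm p q f < +oo)%E.
Proof. by move=> [[]]. Qed.

Lemma tilde_lin a (f g : T -> R) : morrey_tilde p q f -> morrey_tilde p q g ->
  morrey_tilde p q (fun x => a * f x + g x).
Proof.
move=> tf tg; have mf := tilde_measurable tf; have mg := tilde_measurable tg.
split.
  apply: morreyP; first by apply: measurable_funD => //; exact: measurable_funM.
  apply: le_lt_trans (morrey_norm_lin _ _ _) _ => //.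
  by rewrite lte_add_pinfty ?tilde_morrey_norm// lte_mul_pinfty// tilde_morrey_norm.
move=> e e0.
have a1 : 0 < `|a| + 1 by rewrite ltr_wpDl.
have ea : 0 < e / 2 / (`|a| + 1) by rewrite !divr_gt0.
have e2 : 0 < e / 2 by rewrite divr_gt0.
have [s ss fs] := tf.2 _ ea; have [t st gt] := tg.2 _ e2.
exists (fun x => a * s x + t x); first exact: finite_simple_lin.
have ms := finite_simple_measurable ss; have mt := finite_simple_measurable st.
rewrite (_ : _ \- _ = (fun x => a * (f \- s) x + (g \- t) x)); last first.
  by apply/funext => x /=; rewrite mulrBr addrACA -opprD.
apply: le_lt_trans (morrey_norm_lin _ _ _) _; [exact: measurable_funB..|].
rewrite [e]splitr EFinD; apply: lteD => //.
apply: (@le_lt_trans _ _ (`|a|%:E * (e / 2 / (`|a| + 1))%:E)%E).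
  by rewrite lee_wpmul2l// ltW.
by rewrite -EFinM lte_fin mulrCA gtr_pMr// ltr_pdivrMr// mul1r ltrDl.
Qed.

(** The normalization of blocks is exactly what Hoelder's inequality needs. *)
Lemma block_pairing (b f : T -> R) : block p q b -> measurable_fun setT f ->
  (\int[mu]_x `|(f x * b x)%:E| <= morrey_norm p q f)%E.
Proof.
move=> [mb [Q [cQ bQ bn]]] mf; have mQ := measurable_cube cQ.
have mfQ := measurable_fun_restrict mQ mf.
have mbQ := measurable_fun_restrict mQ mb.
rewrite hoelder_conjugate_fin// in bn.
have q'0 : 0 < q / (q - 1) by rewrite divr_gt0// subr_gt0.
have := @hoelder _ _ _ mu _ _ _ _ mfQ mbQ q0 q'0 (hoelder_conjugate_sum q1).
rewrite Lnorm1 (eq_integral (fun x => `|(f x * b x)%:E|)%E); last first.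
  move=> x _ /=; rewrite !patchE; case: ifPn => // xQ.
  by rewrite bQ ?mulr0// => /mem_set; exact/negP.
move=> /le_trans; apply; apply: le_trans (Lnorm_on_le_morrey_norm f cQ).
by rewrite muleC; apply: lee_pmul => //; exact: Lnorm_on_ge0.
Qed.

Lemma l1_norm_ge0 (lambda : nat -> R) : (0 <= l1_norm lambda)%E.
Proof. by apply: nneseries_ge0. Qed.

Lemma block_series_integral (lambda : nat -> R) (b : nat -> T -> R) (f : T -> R) :
    (forall k, block p q (b k)) -> measurable_fun setT f ->
    (morrey_norm p q f < +oo)%E ->
  let h x := (\sum_(0 <= k <oo) `|(f x * (lambda k * b k x))%R%:E|)%E in
  measurable_fun setT h /\
  (\int[mu]_x h x <= l1_norm lambda * morrey_norm p q f)%E.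
Proof.
move=> bb mf foo h.
have mfb k : measurable_fun setT (fun x => (f x * (lambda k * b k x))).
  apply: measurable_funM => //; apply: measurable_funM => //; exact: (bb k).1.
have mafb k : measurable_fun setT (fun x => `|(f x * (lambda k * b k x))%:E|%E).
  by apply: measurableT_comp => //; exact/measurable_EFinP.
have mh : measurable_fun setT h by apply: ge0_emeasurable_sum.
split => //; rewrite integral_nneseries//.
have Mfin : morrey_norm p q f \is a fin_num by rewrite ge0_fin_numE// morrey_norm_ge0.
rewrite /l1_norm muleC -(fineK Mfin) -nneseriesZl//.
apply: lee_nneseries => [k _ _|k _]; first by apply: integral_ge0.
rewrite (eq_integral (fun x => `|lambda k|%:E * `|(f x * b k x)%:E|)%E); last first.
  by move=> x _; rewrite mulrCA EFinM abseM.
rewrite ge0_integralZl//; last first.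
  apply: measurableT_comp => //; apply/measurable_EFinP/measurable_funM => //.
  exact: (bb k).1.
by rewrite fineK// muleC lee_wpmul2r// block_pairing.
Qed.

Lemma block_integrable (b f : T -> R) : block p q b -> measurable_fun setT f ->
  (morrey_norm p q f < +oo)%E -> mu.-integrable setT (EFin \o (f \* b)).
Proof.
move=> bb mf foo; apply/integrableP; split.
  by apply/measurable_EFinP/measurable_funM => //; exact: bb.1.
exact: le_lt_trans (block_pairing bb mf) foo.
Qed.

(** The series of |f lambda_k b_k| is integrable by [block_series_integral] and
    dominates the partial sums of f g. *)
Lemma decomposition_pairing (g : T -> R) lambda (b : nat -> T -> R) (f : T -> R) :
    measurable_fun setT g -> block_decomposition p q g lambda b ->
    measurable_fun setT f -> (morrey_norm p q f < +oo)%E ->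
  [/\ mu.-integrable setT (EFin \o (f \* g)),
      (`|\int[mu]_x (f x * g x)|%:E <= l1_norm lambda * morrey_norm p q f)%E &
      series (fun k => lambda k * \int[mu]_x (f x * b k x)) @ \oo -->
        \int[mu]_x (f x * g x)].
Proof.
move=> mg [bb loo gae] mf foo.
have [mh hle] := block_series_integral lambda bb mf foo.
set h := (fun x => _) in mh hle.
have mfb k : measurable_fun setT (fun x => (f x * (lambda k * b k x))).
  by apply: measurable_funM => //; apply: measurable_funM => //; exact: (bb k).1.
have h0 x : (0 <= h x)%E by exact: nneseries_ge0.
have ih : mu.-integrable setT h.
  apply/integrableP; split => //.
  under eq_integral do rewrite gee0_abs//.
  apply: (le_lt_trans hle); rewrite lte_mul_pinfty// ?l1_norm_ge0//.
  by rewrite ge0_fin_numE// l1_norm_ge0.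
pose F N x := (f x * series (fun k => lambda k * b k x) N)%:E.
have FE N x : F N x = (\sum_(0 <= k < N) (f x * (lambda k * b k x))%:E)%E.
  by rewrite /F /series/= mulr_sumr sumEFin.
have mF N : measurable_fun setT (F N).
  rewrite (funext (FE N)); apply: emeasurable_sum => k.
  exact/measurable_EFinP.
have mfg : measurable_fun setT (EFin \o (f \* g)).
  by apply/measurable_EFinP; exact: measurable_funM.
have Fcvg : {ae mu, forall x, setT x -> F ^~ x @ \oo --> (EFin \o (f \* g)) x}.
  apply: filterS gae => x gx _; apply: cvg_EFin; first exact: nearW.
  exact: cvgMl_tmp.
have Fh : {ae mu, forall x N, setT x -> (`|F N x| <= h x)%E}.
  apply: aeW => x N _; rewrite FE; apply: (le_trans (lee_abs_sum _ _ _)).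
  exact: nneseries_lim_ge.
have [ifg _ cvgF] := dominated_convergence measurableT mF mfg Fcvg ih Fh.
have ifgE : (\int[mu]_x (EFin \o (f \* g)%R) x = (\int[mu]_x (f x * g x))%:E)%E.
  by rewrite fineK//; exact: integrable_fin_num.
have iFE N : (\int[mu]_x F N x =
    (\sum_(0 <= k < N) lambda k * \int[mu]_x (f x * b k x))%:E)%E.
  under eq_integral do rewrite FE.
  have ifb k := block_integrable (bb k) mf foo.
  have E k : (fun x => (f x * (lambda k * b k x))%:E) =
      (fun x => (lambda k)%:E * (EFin \o (f \* b k)%R) x)%E.
    by apply/funext => x; rewrite /= mulrCA.
  rewrite integral_sum//; last first.
    by move=> k; rewrite E; exact: (integrableZl measurableT (lambda k) (ifb k)).
  rewrite -sumEFin; apply: eq_bigr => k _.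
  rewrite E integralZl// EFinM /Rintegral fineK//.
  exact: (integrable_fin_num measurableT (ifb k)).
rewrite ifgE in cvgF.
split => //.
- have cvgA : (fun N => `|\int[mu]_x F N x|)%E @ \oo --> `|(\int[mu]_x (f x * g x))%:E|%E.
    exact: cvg_abse cvgF.
  rewrite -abse_EFin -(cvg_lim _ cvgA)//.
  apply: lime_le; first by apply/cvg_ex; eexists; exact: cvgA.
  apply: nearW => N; apply: le_trans (le_abse_integral _ measurableT (mF N)) _.
  apply: le_trans hle; apply: ge0_le_integral => //; first exact: measurableT_comp.
  move=> x _; rewrite FE; apply: (le_trans (lee_abs_sum _ _ _)).
  exact: nneseries_lim_ge.
- move/fine_cvg : cvgF; apply: cvg_trans; apply: near_eq_cvg; apply: nearW => N /=.
  by rewrite iFE.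
Qed.

End morrey_norm.

(** * From local functionals to the block space *)

Section centered_cubes.
Context {R : realType} {n : nat}.
Local Notation mu := (lebesgue_Rn R n).
Local Notation T := (Rn R n).

Definition centered_cube (j : nat) : set T :=
  [set x | forall i, `|tnth x i| <= j.+1%:R].

Lemma centered_cubeP j : cube (centered_cube j).
Proof.
exists [tuple of nseq n (- j.+1%:R)], (2 * j.+1%:R); split; first by rewrite mulr_gt0.
apply/seteqP; split => x /= H i; have := H i; rewrite tnth_nseq ler_norml;
  rewrite mulrDl mul1r addKr//.
Qed.

Lemma centered_cube_le j k : (j <= k)%N -> centered_cube j `<=` centered_cube k.
Proof. by move=> jk x H i; apply: le_trans (H i) _; rewrite ler_nat ltnS. Qed.

Lemma centered_cube_cover x : exists j, centered_cube j x.
Proof.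
exists (\max_(i < n) Num.truncn `|tnth x i|)%N => i.
apply: le_trans (ltW (truncnS_gt _)) _; rewrite ler_nat ltnS.
exact: leq_bigmax.
Qed.

End centered_cubes.

Section representation.
Context {R : realType} {n : nat}.
Local Notation mu := (lebesgue_Rn R n).
Local Notation T := (Rn R n).
Context (p q : R) (q1 : 1 < q) (qp : q <= p).

Let q0 : 0 < q. Proof. exact: lt_trans q1. Qed.

Lemma block_space_dual (g : T -> R) : block_space p q g ->
  (forall f : T -> R, morrey_tilde p q f ->
        mu.-integrable setT (EFin \o (f \* g))) /\
     dual (morrey_tilde p q) (morrey_norm p q)
       (fun f : T -> R => \int[mu]_x (f x * g x)).
Proof.
move=> [mg /ereal_inf_lt[_ [lambda [b dec] <-] loo]].
have pair f : morrey_tilde p q f -> _ :=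
  fun tf => decomposition_pairing q1 mg dec
    (tilde_measurable tf) (tilde_morrey_norm tf).
have ifg f : morrey_tilde p q f -> mu.-integrable setT (EFin \o (f \* g)).
  by move=> /pair[].
split => //; split; last first.
  exists (fine (l1_norm lambda)) => f tf.
  rewrite fineK ?ge0_fin_numE ?l1_norm_ge0//.
  by have [] := pair _ tf.
move=> c f f' tf tf'.
have icfg : mu.-integrable setT (EFin \o (fun x => c * (f x * g x))).
  exact: (integrableZl measurableT c (ifg f tf)).
under eq_Rintegral do rewrite mulrDl -mulrA.
by rewrite RintegralD ?RintegralZl//; exact: ifg.
Qed.

(** Pairing with the indicator of a cube shows that the series converges absolutely
    almost everywhere on that cube. The upper limit of the partial sums provides a
    limit which is measurable on the whole space. *)
Lemma block_series_cvg (lambda : nat -> R) (b : nat -> T -> R) :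
  (forall k, block p q (b k)) -> (l1_norm lambda < +oo)%E ->
  exists2 g, measurable_fun setT g & block_decomposition p q g lambda b.
Proof.
move=> bb loo.
pose S x := series (fun k => lambda k * b k x).
have mS N : measurable_fun setT (fun x => S x N).
  rewrite (_ : (fun x => _) = fun x => \sum_(0 <= k < N) lambda k * b k x)//.
  by apply: measurable_sum => k; apply: measurable_funM => //; exact: (bb k).1.
exists (fun x => fine (limn_esup (fun N => (S x N)%:E))).
  apply: measurableT_comp => //; apply: measurable_fun_limn_esup => N.
  exact/measurable_EFinP.
split => //.
have abs_fin j : {ae mu, forall x, setT x ->
    (\sum_(0 <= k <oo) `|(\1_(centered_cube j) x * (lambda k * b k x))%R%:E|)%E \is a fin_num}.
  have cj := @centered_cubeP R n j; have mj := measurable_cube cj.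
  have foo := morrey_norm_indic q1 qp mj (cube_lty cj).
  have [mh hle] := block_series_integral q1 lambda bb (measurable_indic mj) foo.
  apply: integrable_ae => //; apply/integrableP; split => //.
  under eq_integral do rewrite gee0_abs ?nneseries_ge0//.
  apply: (le_lt_trans hle); rewrite lte_mul_pinfty ?l1_norm_ge0//.
  by rewrite ge0_fin_numE// l1_norm_ge0.
have := ae_foralln abs_fin; apply: filterS => x xfin.
have [j xj] := centered_cube_cover x.
have {xfin} := xfin j Logic.I.
rewrite (eq_eseriesr (g := fun k => `|(lambda k * b k x)%:E|%E)); last first.
  by move=> k _; rewrite indicE mem_set// mul1r.
move=> xfin.
have cvgS : cvgn (S x).
  apply: normed_cvg; apply: nondecreasing_is_cvgn.
    move=> N M NM /=; rewrite /series/= (big_cat_nat (leq0n N) NM)/= lerDl.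
    exact: sumr_ge0.
  exists (fine (\sum_(0 <= k <oo) `|(lambda k * b k x)%:E|)%E) => _ [N _ <-].
  rewrite -lee_fin fineK// /series/= -sumEFin.
  exact: nneseries_lim_ge.
have cvgE : (fun N => (S x N)%:E) @ \oo --> (limn (S x))%:E.
  by apply: cvg_EFin; [exact: nearW|exact: cvgS].
rewrite is_cvg_limn_esupE; last by apply/cvg_ex; eexists; exact: cvgE.
by rewrite (cvg_lim _ cvgE).
Qed.

(** The densities G_k of the local functionals are c_k times blocks. When c_k = 0,
    the convention 1 / 0 = 0 makes the quotient G_k / c_k the zero function, which
    is a block, and the k-th functional vanishes as well. *)
Lemma dual_of_local_functionals (L : (T -> R) -> R) (Lam : nat -> (T -> R) -> R)
    (Q : nat -> set T) (c : nat -> R) (C : R) :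
  dual (morrey_tilde p q) (morrey_norm p q) L ->
  (forall k, cube (Q k)) -> (forall k, 0 <= c k) ->
  (forall N, \sum_(k < N) c k <= C) ->
  (forall k a f g, finite_simple f -> finite_simple g ->
     Lam k (fun x => a * f x + g x) = a * Lam k f + Lam k g) ->
  (forall k f, finite_simple f -> `|Lam k f| <=
     c k * (volume (Q k) `^ (p^-1 - q^-1) * fine (Lnorm_on q%:E (Q k) f))) ->
  (forall f, finite_simple f -> series (Lam^~ f) @ \oo --> L f) ->
  exists2 g : T -> R, block_space p q g &
    forall f : T -> R, morrey_tilde p q f ->
      mu.-integrable setT (EFin \o (f \* g)) /\ L f = \int[mu]_x (f x * g x).
Proof.
move=> [L_lin [CL L_le]] cQ c0 cC Lam_lin Lam_le Lam_cvg.
pose w k := volume (Q k) `^ (p^-1 - q^-1).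
have w0 k : 0 <= w k by exact: powR_ge0.
have dens k : exists G : T -> R, [/\ measurable_fun setT G,
    forall x, ~ Q k x -> G x = 0,
    forall f, finite_simple f -> mu.-integrable setT (EFin \o (f \* G)) /\
      Lam k f = \int[mu]_x (f x * G x) &
    (Lnorm_on (hoelder_conjugate q%:E) (Q k) G <= (c k * w k)%:E)%E].
  apply: riesz_density => //;
    [exact: measurable_cube|exact: cube_lty|exact: mulr_ge0|exact: Lam_lin|].
  by move=> f sf; rewrite -mulrA; exact: Lam_le.
have [G GP] := choice dens.
pose b k x := (c k)^-1 * G k x.
have bb k : block p q (b k).
  have [mG GQ _ Gn] := GP k; have mQ := measurable_cube (cQ k).
  split; first exact: measurable_funM.
  exists (Q k); split => //; first by move=> x /GQ Gx; rewrite /b Gx mulr0.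
  rewrite hoelder_conjugate_fin// in Gn *.
  rewrite Lnorm_onZ ?divr_gt0 ?subr_gt0//.
  apply: le_trans (lee_wpmul2l _ Gn) _ => //.
  rewrite ger0_norm ?invr_ge0// -EFinM lee_fin mulrA.
  have [->|ck] := eqVneq (c k) 0; first by rewrite mulr0 mul0r powR_ge0.
  by rewrite mulVf// mul1r.
have loo : (l1_norm c < +oo)%E.
  apply: (@le_lt_trans _ _ C%:E); last exact: ltry.
  apply: lime_le; first exact: is_cvg_nneseries.
  apply: nearW => N; rewrite big_mkord sumEFin lee_fin.
  by under eq_bigr do rewrite ger0_norm//.
have [g mg dec] := block_series_cvg bb loo.
have gB : block_space p q g.
  split => //; apply: le_lt_trans loo; apply: ereal_inf_lbound.
  by exists c => //; exists b.
have [ifg [g_lin [Cg g_le]]] := block_space_dual gB.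
exists g => // f tf; split; first exact: ifg.
have Ls s : finite_simple s -> L s = \int[mu]_x (s x * g x).
  move=> ss; have ts := finite_simple_tilde q1 qp ss.
  have [_ _ cvgs] := decomposition_pairing q1 mg dec
    (tilde_measurable ts) (tilde_morrey_norm ts).
  have cvgL := Lam_cvg _ ss; rewrite -(cvg_lim _ cvgL)// -(cvg_lim _ cvgs)//.
  congr (limn (series _)).
  apply/funext => k; have [_ _ /(_ _ ss)[isG LG] _] := GP k.
  have [ck|ck] := eqVneq (c k) 0.
    apply/eqP; rewrite ck mul0r -normr_le0 (le_trans (Lam_le _ _ ss))//.
    by rewrite ck mul0r.
  rewrite LG /b; under [in RHS]eq_Rintegral do rewrite mulrCA.
  by rewrite RintegralZl// mulVKf.
apply/eqP; rewrite -subr_eq0 -normr_le0; apply/ler_addgt0Pr => e e0; rewrite add0r.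
pose C' := `|CL| + `|Cg| + 1.
have C'0 : 0 < C' by rewrite ltr_wpDl// addr_ge0.
have [s ss fs] := tf.2 _ (divr_gt0 e0 C'0).
have ts := finite_simple_tilde q1 qp ss.
have tfs := tilde_lin q1 (-1) ts tf.
have fsE : (fun x => -1 * s x + f x) = f \- s.
  by apply/funext => x /=; rewrite mulN1r addrC.
have -> : L f - \int[mu]_x (f x * g x) =
    L (f \- s) - \int[mu]_x ((f \- s) x * g x).
  rewrite -fsE L_lin// g_lin// (Ls _ ss).
  by rewrite !mulN1r opprD opprK addrACA addNr add0r.
rewrite fsE in tfs.
have Nfin : morrey_norm p q (f \- s) \is a fin_num.
  by rewrite ge0_fin_numE ?tilde_morrey_norm// morrey_norm_ge0.
have bnd (D x : R) : (`|x|%:E <= D%:E * morrey_norm p q (f \- s)%R)%E ->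
    `|x| <= `|D| * (e / C').
  move: fs; rewrite -(fineK Nfin) lte_fin -EFinM lee_fin => fs /le_trans; apply.
  apply: (@le_trans _ _ (`|D| * fine (morrey_norm p q (f \- s)))).
    by rewrite ler_wpM2r ?ler_norm// fine_ge0// morrey_norm_ge0.
  by rewrite ler_wpM2l// ltW.
apply: le_trans (ler_normB _ _) _.
apply: (@le_trans _ _ (`|CL| * (e / C') + `|Cg| * (e / C'))).
  by apply: lerD; apply: bnd; [exact: L_le|exact: g_le].
rewrite -mulrDl mulrCA ger_pMr// ler_pdivrMr// mul1r lerDl//.
Qed.

End representation.

(** * Splitting a functional when q < p *)

Section grid.
Context {R : realType} {n : nat}.
Local Notation mu := (lebesgue_Rn R n).
Local Notation T := (Rn R n).

(** The index (j, m) stands for the cube with side 2 * 2^j and lower corner 2^j m. As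
    the side is twice the mesh, neighbouring cubes overlap, and every cube lies in
    a grid cube of comparable size. *)
Definition grid_index := (int * {ffun 'I_n -> int})%type.

Definition grid_cube (jm : grid_index) : set T :=
  [set x | forall i, 2 ^ jm.1 * (jm.2 i)%:~R <= tnth x i <=
                     2 ^ jm.1 * (jm.2 i)%:~R + 2 * 2 ^ jm.1].

Lemma grid_cubeE jm : grid_cube jm =
  [set x | forall i, tnth [tuple 2 ^ jm.1 * (jm.2 i)%:~R | i < n] i <= tnth x i <=
     tnth [tuple 2 ^ jm.1 * (jm.2 i)%:~R | i < n] i + 2 * 2 ^ jm.1].
Proof. by apply/seteqP; split => x H i; have := H i; rewrite tnth_mktuple. Qed.

Let exp2_gt0 (j : int) : 0 < 2 ^ j :> R. Proof. by rewrite exprz_gt0. Qed.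

Lemma grid_cubeP jm : cube (grid_cube jm).
Proof.
exists [tuple 2 ^ jm.1 * (jm.2 i)%:~R | i < n], (2 * 2 ^ jm.1).
by split; [rewrite mulr_gt0|exact: grid_cubeE].
Qed.

Lemma volume_grid_cube jm : volume (grid_cube jm) = (2 * 2 ^ jm.1) ^+ n.
Proof. by rewrite grid_cubeE volume_cube// mulr_ge0// ltW. Qed.

(** Multiplied by a power of 2, l exceeds 1, and then the base 2 logarithm of its
    integer part gives the scale. *)
Lemma dyadic_scale (l : R) : 0 < l -> exists j : int, l <= 2 ^ j <= 2 * l.
Proof.
move=> l0; pose i := Num.truncn l^-1.
have i1 : l^-1 < 2 ^+ i.+1.
  by apply: lt_le_trans (truncnS_gt _) _; rewrite -natrX ler_nat ltnW// ltn_expl.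
pose y := l * 2 ^+ i.+1.
have y1 : 1 <= y by rewrite /y -ler_pdivrMl// mulr1 ltW.
pose e := trunc_log 2 (Num.truncn y).
have ty : (0 < Num.truncn y)%N by rewrite truncn_gt0.
have /andP[e1 e2] := trunc_log_bounds (isT : (1 < 2)%N) ty.
have ey1 : 2 ^+ e <= y.
  rewrite -natrX; apply: le_trans (_ : (Num.truncn y)%:R <= y); first by rewrite ler_nat.
  by rewrite truncn_le// (le_trans _ y1).
have ey2 : y < 2 ^+ e.+1.
  by rewrite -natrX; apply: lt_le_trans (truncnS_gt _) _; rewrite ler_nat.
exists (e.+1%:Z - i.+1%:Z).
rewrite expfzDr ?pnatr_eq0// -exprnN -exprnP.
apply/andP; split.
  by rewrite ler_pdivlMr ?exprn_gt0// ltW.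
by rewrite ler_pdivrMr ?exprn_gt0// -mulrA exprS ler_pM2l.
Qed.

Lemma grid_cover Q : cube Q ->
  exists jm, Q `<=` grid_cube jm /\ volume (grid_cube jm) <= 4 ^+ n * volume Q.
Proof.
move=> [a [l [l0 ->]]]; have [j /andP[lj jl]] := dyadic_scale l0.
exists (j, [ffun i => Num.floor (tnth a i / 2 ^ j)]); split; last first.
  rewrite volume_grid_cube (volume_cube _ (ltW l0))/= -exprMn.
  apply: lerXn2r; rewrite ?nnegrE; [by rewrite mulr_ge0// ltW..|].
  have -> : 4 * l = 2 * (2 * l) by rewrite mulrA -natrM.
  by rewrite ler_pM2l.
move=> x H i /=; rewrite ffunE.
have /andP[x1 x2] := H i.
have /andP[f1 f2] := floor_itv (tnth a i / 2 ^ j).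
have g1 : 2 ^ j * (Num.floor (tnth a i / 2 ^ j))%:~R <= tnth a i.
  by rewrite mulrC -ler_pdivlMr.
have g2 : tnth a i <= 2 ^ j * (Num.floor (tnth a i / 2 ^ j))%:~R + 2 ^ j.
  move: f2; rewrite ltr_pdivrMr// => /ltW; rewrite intrD1 mulrDl mul1r mulrC => //.
rewrite (le_trans g1 x1)/= (le_trans x2)// mulrDl mul1r addrA.
exact: lerD.
Qed.

Lemma bounded_int (B : nat) (z : int) : (`|z| <= B)%N ->
  exists t : 'I_(B + B).+1, z = t%:Z - B%:Z.
Proof.
move=> zB; have zB' : (0 <= z + B%:Z <= (B + B)%:Z)%R by lia.
have : (`|(z + B%:Z)%R| < (B + B).+1)%N by lia.
by move=> H; exists (Ordinal H) => /=; lia.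
Qed.

(** Only finitely many indices have bounded entries, so they have bounded codes. *)
Lemma bounded_grid_index (J B : nat) : exists k0 : nat, forall jm : grid_index,
  (`|jm.1| <= J)%N -> (forall i, `|jm.2 i| <= B)%N -> (pickle jm < k0)%N.
Proof.
pose conv (t : 'I_(J + J).+1 * {ffun 'I_n -> 'I_(B + B).+1}) : grid_index :=
  (t.1%:Z - J%:Z, [ffun i => (t.2 i)%:Z - B%:Z]).
exists (\max_t pickle (conv t)).+1 => -[j m] /= jJ mB.
have [t1 jt] := bounded_int jJ.
have [t2 mt] := choice (fun i => bounded_int (mB i)).
rewrite ltnS (_ : (j, m) = conv (t1, [ffun i => t2 i])); first exact: leq_bigmax.
by rewrite /conv/= -jt; congr pair; apply/ffunP => i; rewrite !ffunE.
Qed.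


Lemma volume_grid_cube_large k m : (0 < n)%N ->
  k%:R <= volume (grid_cube (Posz k, m)).
Proof.
move=> n0; rewrite volume_grid_cube/= -exprnP -exprS.
apply: (@le_trans _ _ (2 ^+ k.+1)).
  by rewrite -natrX ler_nat ltnW// (ltn_trans (ltnSn k))// ltn_expl.
rewrite -[leLHS]expr1 ler_weXn2l// -natrX ler1n expn_gt0//.
Qed.

Lemma volume_grid_cube_small k m : (0 < n)%N ->
  volume (grid_cube (Negz k, m)) <= k.+1%:R^-1.
Proof.
move=> n0; rewrite volume_grid_cube/= NegzE -exprnN exprS invfM mulVKf ?pnatr_eq0//.
have k2 : 0 < 2 ^+ k :> R by rewrite exprn_gt0.
apply: (@le_trans _ _ (2 ^+ k)^-1).
  rewrite -[leRHS]expr1 ler_wiXn2l ?invr_ge0 ?(ltW k2)// invf_le1//.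
  by rewrite -natrX ler1n expn_gt0.
by rewrite lef_pV2 ?posrE// -natrX ler_nat ltn_expl.
Qed.

Lemma grid_index_bounded_near M J jm x : (`|jm.1| <= J)%N ->
  grid_cube jm x -> centered_cube M x ->
  forall i, (`|jm.2 i| <= M.+1 * 2 ^ J + 2)%N.
Proof.
move=> jJ Gx Mx i; have /andP[x1 x2] := Gx i; have := Mx i.
rewrite ler_norml => /andP[M1 M2].
set j := jm.1 in jJ x1 x2; set m := jm.2 i in x1 x2 *.
have Nj : 2 ^ (- j) <= 2 ^+ J :> R.
  by rewrite [2 ^+ J]exprnP ler_eXz2l ?ltr1n//; lia.
have jN : 2 ^ j * 2 ^ (- j) = 1 :> R by rewrite -expfzDr ?pnatr_eq0// subrr.
have Mle : M.+1%:R * 2 ^ (- j) <= M.+1%:R * 2 ^+ J :> R by rewrite ler_pM2l.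
have m1 : m%:~R <= M.+1%:R * 2 ^+ J :> R.
  apply: le_trans Mle.
  have -> : m%:~R = 2 ^ j * m%:~R * 2 ^ (- j) :> R by rewrite mulrAC jN mul1r.
  by rewrite ler_pM2r// (le_trans x1).
have m2 : - (M.+1%:R * 2 ^+ J + 2) <= m%:~R :> R.
  rewrite opprD lerBlDr; apply: (@le_trans _ _ (- (M.+1%:R * 2 ^ (- j)))).
    by rewrite lerN2.
  rewrite -mulNr; have -> : m%:~R + 2 = (2 ^ j * m%:~R + 2 * 2 ^ j) * 2 ^ (- j) :> R.
    by rewrite mulrDl -!mulrA [2 ^ j * _]mulrC -!mulrA jN mulr1 [2 ^ (- j) * _]mulrC jN mulr1.
  by rewrite ler_pM2r// (le_trans M1).
have BE : M.+1%:R * 2 ^+ J + 2 = (M.+1 * 2 ^ J + 2)%N%:~R :> R.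
  by rewrite -pmulrn natrD natrM natrX.
have {}m2 : - (M.+1 * 2 ^ J + 2)%N%:Z <= m.
  by rewrite -(ler_int R) mulrNz -BE.
have {}m1 : m <= (M.+1 * 2 ^ J + 2)%N%:Z.
  by rewrite -(ler_int R) -BE (le_trans m1)// lerDl.
by move: m1 m2; set B := (M.+1 * 2 ^ J + 2)%N; lia.
Qed.

End grid.

Section strict_case.
Context {R : realType} {n : nat}.
Local Notation mu := (lebesgue_Rn R n).
Local Notation T := (Rn R n).
Context (p q : R) (n0 : (0 < n)%N) (q1 : 1 < q) (qp : q < p).

Let q0 : 0 < q. Proof. exact: lt_trans q1. Qed.
Let p0 : 0 < p. Proof. exact: lt_trans qp. Qed.

Lemma measure_outside_centered_cube (A : set T) (d : R) : measurable A ->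
  (mu A < +oo)%E -> 0 < d -> exists M, (mu (A `\` centered_cube M) <= d%:E)%E.
Proof.
move=> mA Aoo d0; pose F M := A `\` @centered_cube R n M.
have mF M : measurable (F M).
  by apply: measurableD => //; exact: measurable_cube (centered_cubeP M).
have F0 : \bigcap_M F M = set0.
  rewrite -subset0 => x Fx; have [j xj] := centered_cube_cover x.
  by have [] := Fx j Logic.I.
have : mu \o F @ \oo --> 0%E.
  rewrite -(measure0 mu) -F0; apply: nonincreasing_cvg_mu => //.
  - by apply: le_lt_trans Aoo; apply: le_measure; rewrite ?inE//; exact: subDsetl.
  - exact: bigcap_measurable.
  - by move=> i j ij; apply/subsetPset; apply: setDS; exact: centered_cube_le.
move=> /fine_cvgP[[N1 _ HN1]] /cvgr0Pnorm_le/(_ _ d0)[N2 _ HN2].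
exists (maxn N1 N2).
have Ffin := HN1 (maxn N1 N2) (leq_maxl _ _).
have := HN2 (maxn N1 N2) (leq_maxr _ _) => /= FN2.
rewrite -[leLHS](fineK Ffin) lee_fin.
exact: le_trans (ler_norm _) FN2.
Qed.

(** Let V be the volume of the grid cube and t the measure of its intersection with
    A. The quantity V^(1/p - 1/q) t^(1/q) is small in three situations: V is small,
    as t <= V bounds it by V^(1/p); V is large, as t is at most the measure of A; and
    t is small while V is bounded below. Cubes of moderate size that do not meet a
    large centered cube are in the third situation, and only finitely many grid
    cubes remain. *)
Lemma grid_indic_vanish (A : set T) (e : R) : measurable A -> (mu A < +oo)%E ->
    0 < e -> exists k0, forall jm : @grid_index n, (k0 <= pickle jm)%N ->
  volume (grid_cube jm) `^ (p^-1 - q^-1) *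
    fine (Lnorm_on q%:E (grid_cube jm) (\1_A : T -> R)) <= e.
Proof.
move=> mA Aoo e0; pose s := q^-1 - p^-1.
have s0 : 0 < s by rewrite subr_gt0 ltf_pV2 ?posrE.
have qi0 : 0 <= q^-1 by rewrite invr_ge0 ltW.
pose a := fine (mu A); pose v0 := e `^ p; pose K := (a `^ q^-1 / e) `^ s^-1.
have v00 : 0 < v0 by rewrite powR_gt0.
pose d := (e * v0 `^ s) `^ q.
have d0 : 0 < d by rewrite powR_gt0// mulr_gt0// powR_gt0.
have [M HM] := measure_outside_centered_cube mA Aoo d0.
pose J := maxn (Num.truncn K).+1 (Num.truncn v0^-1).+1.
have [k0 Hk0] := @bounded_grid_index n J (M.+1 * 2 ^ J + 2).
exists k0 => jm k0jm; set Q := grid_cube jm.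
have cQ : cube Q := @grid_cubeP R n jm.
have mQ := measurable_cube cQ.
have V0 := volume_gt0 cQ; set V := volume Q in V0 *.
have AQA : (mu (A `&` Q) <= mu A)%E by exact: measureIl.
have AQQ : (mu (A `&` Q) <= mu Q)%E by exact: measureIr.
have AQfin : mu (A `&` Q) \is a fin_num by rewrite ge0_fin_numE// (le_lt_trans AQA).
pose t := fine (mu (A `&` Q)).
have t0 : 0 <= t by exact: fine_ge0.
have tV : t <= V by rewrite -lee_fin fineK// volumeE.
have ta : t <= a by rewrite /t /a fine_le// ge0_fin_numE.
rewrite Lnorm_on_indic// fine_poweR -/t -opprB -/s powRN ler_pdivrMl ?powR_gt0//.
have small : V <= v0 -> t `^ q^-1 <= V `^ s * e.
  move=> Vv; apply: (@le_trans _ _ (V `^ q^-1)).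
    by apply: ge0_ler_powR; rewrite ?nnegrE// ltW.
  rewrite -[q^-1](subrK p^-1) powRD ?(gt_eqF V0) ?implybT// ler_pM2l ?powR_gt0//.
  have -> : e = v0 `^ p^-1 by rewrite /v0 -powRrM mulfV ?gt_eqF// powRr1// ltW.
  by apply: ge0_ler_powR; rewrite ?nnegrE ?invr_ge0// ltW.
have large : K <= V -> t `^ q^-1 <= V `^ s * e.
  move=> KV; apply: (@le_trans _ _ (a `^ q^-1)).
    by apply: ge0_ler_powR; rewrite ?nnegrE// (le_trans t0).
  rewrite -ler_pdivrMr//.
  have -> : a `^ q^-1 / e = K `^ s.
    by rewrite /K -powRrM mulVf ?gt_eqF// powRr1// divr_ge0 ?powR_ge0// ltW.
  by apply: ge0_ler_powR; rewrite ?nnegrE ?powR_ge0// ltW.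
have [jJ|Jj] := leqP `|jm.1| J; last first.
  have KJ : K <= J%:R.
    by rewrite (le_trans (ltW (truncnS_gt _)))// ler_nat leq_maxl.
  have vJ : v0^-1 <= J%:R.
    by rewrite (le_trans (ltW (truncnS_gt _)))// ler_nat leq_maxr.
  have jmE : jm = (jm.1, jm.2) by case: (jm).
  case jE : jm.1 Jj => [k|k] Jk.
    apply: large; apply: (le_trans KJ); rewrite /V /Q jmE jE.
    by apply: le_trans (volume_grid_cube_large _ _ n0); rewrite ler_nat ltnW.
  apply: small; rewrite /V /Q jmE jE; apply: (le_trans (volume_grid_cube_small _ _ n0)).
  rewrite -[leRHS]invrK lef_pV2 ?posrE ?invr_gt0//.
  by rewrite (le_trans vJ)// ler_nat ltnW.
have [Vv|/ltW vV] := leP V v0; first exact: small.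
suff td : t <= d.
  apply: (@le_trans _ _ (d `^ q^-1)); first by apply: ge0_ler_powR; rewrite ?nnegrE// ltW.
  rewrite /d -powRrM mulfV ?gt_eqF// powRr1; last by rewrite mulr_ge0 ?powR_ge0// ltW.
  rewrite mulrC ler_pM2r//; by apply: ge0_ler_powR; rewrite ?nnegrE// ltW.
rewrite -lee_fin fineK//; apply: le_trans HM.
apply: le_measure; rewrite ?inE.
- exact: measurableI.
- by apply: measurableD => //; exact: measurable_cube (centered_cubeP M).
- move=> x [Ax Qx]; split => // Mx.
  have := Hk0 jm jJ (grid_index_bounded_near jJ Qx Mx).
  by rewrite ltnNge k0jm.
Qed.

(* Natural numbers that do not code an index get weight 0, so that no cube is
   repeated infinitely often in the sequence of seminorms. *)
Let weight (k : nat) : R :=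
  if @pickle_inv (@grid_index n) k is Some jm
  then volume (@grid_cube R n jm) `^ (p^-1 - q^-1) else 0.

Let Qk (k : nat) : set T :=
  grid_cube (odflt (0, [ffun=> 0]) (@pickle_inv (@grid_index n) k)).

Let cQk k : cube (Qk k). Proof. exact: grid_cubeP. Qed.

Let mQk k : measurable (Qk k). Proof. exact: measurable_cube. Qed.

Let weight_ge0 k : 0 <= weight k.
Proof. by rewrite /weight; case: pickle_inv => // jm; rewrite powR_ge0. Qed.

Let Nk (k : nat) (f : T -> R) : R := weight k * Lseminorm q (Qk k) f.

Let Nk_vanish (f : T -> R) : finite_simple f -> Nk^~ f @ \oo --> 0.
Proof.
move: f; apply: weighted_Lseminorm_cvg0 => // A mA Aoo.
apply/cvgr0Pnorm_le => e e0; have [k0 Hk0] := grid_indic_vanish mA Aoo e0.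
exists k0 => // k /= k0k.
rewrite ger0_norm; last by rewrite mulr_ge0// Lseminorm_ge0.
rewrite /weight /Qk; case E : pickle_inv => [jm|]; last by rewrite mul0r ltW.
apply: Hk0.
by have := @pickle_invK (@grid_index n) k; rewrite E /= => ->.
Qed.

(* Every cube lies in a grid cube whose volume is at most 4^n times larger, so the
   grid seminorms control the Morrey norm. *)
Let Nk_dom (f : T -> R) B : finite_simple f -> (forall k, Nk k f <= B) ->
  (morrey_norm p q f <= ((4 ^+ n) `^ (q^-1 - p^-1) * B)%:E)%E.
Proof.
move=> sf fB.
have s0 : 0 <= q^-1 - p^-1 by rewrite subr_ge0 lef_pV2 ?posrE// ltW.
apply: morrey_norm_le => Q cQ; have mQ := measurable_cube cQ.
have [jm [Qjm Vjm]] := grid_cover cQ.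
have cjm := @grid_cubeP R n jm; have mjm := measurable_cube cjm.
have := fB (pickle jm); rewrite /Nk /weight /Qk pickleK_inv/=.
set V' := volume (grid_cube jm) in Vjm *; have V'0 : 0 < V' by exact: volume_gt0.
have V0 := volume_gt0 cQ.
move=> H; apply: (@le_trans _ _ ((4 ^+ n) `^ (q^-1 - p^-1) *
    (V' `^ (p^-1 - q^-1) * Lseminorm q (grid_cube jm) f))%:E).
  rewrite -LseminormK// -EFinM lee_fin mulrA.
  apply: ler_pM; rewrite ?powR_ge0 ?Lseminorm_ge0//; last exact: le_Lseminorm.
  rewrite -[p^-1 - q^-1]opprB !powRN ler_pdivlMr ?powR_gt0//.
  rewrite ler_pdivrMl ?powR_gt0// mulrC -powRM ?exprn_ge0//; last exact: ltW.
  apply: ge0_ler_powR => //; rewrite nnegrE; first exact: ltW.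
  by rewrite mulr_ge0 ?exprn_ge0// ltW.
by rewrite lee_fin ler_wpM2l ?powR_ge0.
Qed.

Lemma predual_strict (L : (T -> R) -> R) :
  dual (morrey_tilde p q) (morrey_norm p q) L ->
  exists2 g : T -> R, block_space p q g &
    forall f : T -> R, morrey_tilde p q f ->
      mu.-integrable setT (EFin \o (f \* g)) /\ L f = \int[mu]_x (f x * g x).
Proof.
move=> LP; have [L_lin [CL L_le]] := LP.
have qp' := ltW qp.
have [|||||||||Lam [c [Lam_lin Lam_le c0 cC Lam_cvg]]] :=
  @sup_seminorm_decomposition R (T -> R^o) (@finite_simple R n) Nk
    (`|CL| * (4 ^+ n) `^ (q^-1 - p^-1)) L.
- exact: finite_simple0.
- by move=> a f g sf sg; exact: finite_simple_lin.
- by move=> k f; rewrite mulr_ge0// Lseminorm_ge0.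
- by move=> k a f sf; rewrite /Nk LseminormZ// mulrCA.
- by move=> k f g sf sg; rewrite -mulrDr ler_wpM2l// LseminormD.
- exact: Nk_vanish.
- by rewrite mulr_ge0 ?powR_ge0.
- by move=> a f g sf sg; apply: L_lin; exact: finite_simple_tilde.
- move=> f B sf fB; have tf := finite_simple_tilde q1 qp' sf.
  have Nfin : morrey_norm p q f \is a fin_num.
    by rewrite ge0_fin_numE ?tilde_morrey_norm// morrey_norm_ge0.
  apply: (le_trans (ler_norm _)); rewrite -mulrA.
  have := L_le f tf; have := Nk_dom sf fB.
  rewrite -(fineK Nfin) -EFinM !lee_fin => H1 /le_trans; apply.
  apply: (@le_trans _ _ (`|CL| * fine (morrey_norm p q f))).
    by rewrite ler_wpM2r ?ler_norm// fine_ge0// morrey_norm_ge0.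
  by rewrite ler_wpM2l.
apply: (@dual_of_local_functionals _ _ _ _ q1 qp' L Lam Qk c
  (`|CL| * (4 ^+ n) `^ (q^-1 - p^-1))) => //.
move=> k f sf; apply: (le_trans (Lam_le k f sf)); rewrite ler_wpM2l//.
rewrite ler_wpM2r ?Lseminorm_ge0// /weight /Qk.
by case: pickle_inv => [jm|]/=; [exact: lexx|exact: powR_ge0].
Qed.

End strict_case.

(** * Splitting a functional when q = p *)

Section equal_case.
Context {R : realType} {n : nat}.
Local Notation mu := (lebesgue_Rn R n).
Local Notation T := (Rn R n).
Context (q : R) (q1 : 1 < q).

Let q0 : 0 < q. Proof. exact: lt_trans q1. Qed.

Local Notation cc := (@centered_cube R n).
Local Notation N := (Lseminorm q setT).

Let mcc j : measurable (cc j). Proof. exact: measurable_cube (centered_cubeP j). Qed.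

Lemma morrey_norm_le_Lseminorm (f : T -> R) : finite_simple f ->
  (morrey_norm q q f <= (N f)%:E)%E.
Proof.
move=> sf; apply: morrey_norm_le => Q cQ; have mQ := measurable_cube cQ.
by rewrite subrr powRr0 mul1e -LseminormK// lee_fin; exact: le_Lseminorm.
Qed.

Lemma Lseminorm_outside_cvg0 (f : T -> R) : finite_simple f ->
  (fun j => Lseminorm q (~` cc j) f) @ \oo --> 0.
Proof.
move=> sf.
have mC j : measurable (~` cc j) by exact: measurableC.
have := @weighted_Lseminorm_cvg0 R n q q1 (fun=> 1) (fun j => ~` cc j) _ mC _ f sf.
under eq_fun do rewrite mul1r.
apply => // A mA Aoo; apply/cvgr0Pnorm_le => e e0.
have eq0 : 0 < e `^ q by rewrite powR_gt0.
have [M HM] := measure_outside_centered_cube mA Aoo eq0.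
exists M => // j /= Mj; rewrite mul1r ger0_norm ?Lseminorm_ge0//.
rewrite -lee_fin LseminormK//; last exact: finite_simple_indic.
rewrite Lnorm_on_indic//.
have -> : e%:E = ((e `^ q)%:E `^ q^-1)%E.
  by rewrite poweR_EFin -powRrM mulfV ?gt_eqF// powRr1// ltW.
apply: ge0_le_poweR => //; first by rewrite invr_ge0 ltW.
apply: le_trans HM; apply: le_measure; rewrite ?inE.
- exact: measurableI.
- exact: measurableD.
- by move=> x [Ax nx]; split => // Mx; apply: nx; exact: centered_cube_le Mx.
Qed.

Lemma Lseminorm_powD (f g : T -> R) : finite_simple f -> finite_simple g ->
  (forall x, f x = 0 \/ g x = 0) ->
  N (fun x => f x + g x) `^ q = N f `^ q + N g `^ q.
Proof.
move=> sf sg fg0.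
have sfg : finite_simple (fun x => f x + g x).
  by have := finite_simple_lin 1 sf sg; under eq_fun do rewrite mul1r.
have NE h : finite_simple h -> (N h `^ q)%:E = (\int[mu]_x (`|h x| `^ q)%:E)%E.
  by move=> sh; rewrite -poweR_EFin LseminormK// Lnorm_on_poweR.
apply: EFin_inj; rewrite EFinD !NE//.
rewrite -ge0_integralD//; last 2 first.
- by apply: measurable_powR_norm; exact: finite_simple_measurable.
- by apply: measurable_powR_norm; exact: finite_simple_measurable.
apply: eq_integral => x _; rewrite -EFinD; congr EFin.
by have [->|->] := fg0 x; rewrite ?add0r ?addr0 normr0 powR0 ?add0r ?addr0// gt_eqF.
Qed.

Context (L : (T -> R) -> R) (C : R) (C0 : 0 <= C).
Hypothesis L_lin : forall a f g, finite_simple f -> finite_simple g ->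
  L (fun x => a * f x + g x) = a * L f + L g.
Hypothesis L_le : forall f, finite_simple f -> `|L f| <= C * N f.

Let L0 : L (cst 0) = 0.
Proof.
have := @L_lin (-1) _ _ (@finite_simple0 R n) (@finite_simple0 R n).
rewrite mulN1r addNr; apply: etrans; congr L; apply/funext => x.
by rewrite /= mulr0 addr0.
Qed.

Let LZ a f : finite_simple f -> L (fun x => a * f x) = a * L f.
Proof.
move=> sf; have := L_lin a sf (@finite_simple0 R n); rewrite L0 addr0 => <-.
by congr L; apply/funext => x; rewrite addr0.
Qed.

Let LB f D : finite_simple f -> measurable D ->
  `|L f - L (f \_ D)| <= C * Lseminorm q (~` D) f.
Proof.
move=> sf mD; have sfD := finite_simple_restrict sf mD.
have sfDC := finite_simple_restrict sf (measurableC mD).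
rewrite -Lseminorm_restrict (_ : L f - L (f \_ D) = L (f \_ (~` D))); first exact: L_le.
apply/eqP; rewrite subr_eq; apply/eqP; rewrite -[X in X + _]mul1r -L_lin//.
congr L; apply/funext => x; rewrite !patchE in_setC mul1r.
by case: (x \in D); rewrite ?add0r ?addr0.
Qed.

Let cvgLcc f : finite_simple f -> (fun j => L (f \_ (cc j))) @ \oo --> L f.
Proof.
move=> sf; apply/cvgrPdist_le => e e0.
have eC : 0 < e / (C + 1) by rewrite divr_gt0// ltr_wpDl.
have /cvgr0Pnorm_le/(_ _ eC) := Lseminorm_outside_cvg0 sf.
apply: filterS => j; rewrite ger0_norm ?Lseminorm_ge0// => H.
apply: (le_trans (LB sf (mcc j))).
apply: (@le_trans _ _ (C * (e / (C + 1)))); first by rewrite ler_wpM2l.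
by rewrite mulrCA ger_pMr// ler_pdivrMr ?mul1r ?lerDl// ltr_wpDl.
Qed.

(** Otherwise there are functions f_1, f_2, ... of norm at most 1 with L f_i > e, each
    supported in a bounded set beyond the supports of its predecessors. The sum of
    k of them has norm at most k^(1/q), whence k e <= C k^(1/q) for all k, which is
    impossible as q > 1. *)
Lemma tail_functional_small e : 0 < e -> exists J, forall f, finite_simple f ->
  (forall x, cc J x -> f x = 0) -> `|L f| <= e * N f.
Proof.
move=> e0; apply: contrapT => /forallNP nJ.
have unit J : exists f i, [/\ finite_simple f, forall x, cc J x -> f x = 0,
    forall x, ~ cc i x -> f x = 0, e < L f & N f `^ q <= 1].
  have /existsNP[f /not_implyP[sf /not_implyP[fJ /negP]]] := nJ J.
  rewrite -ltNge => Lf.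
  have Nf0 : 0 < N f.
    rewrite lt_neqAle Lseminorm_ge0 andbT; apply/eqP => Nf.
    have := le_lt_trans (mulr_ge0 (ltW e0) (Lseminorm_ge0 q setT f))
      (lt_le_trans Lf (L_le sf)).
    by rewrite -Nf mulr0 ltxx.
  pose a := Num.sg (L f) / N f.
  have La : e < L (fun x => a * f x).
    by rewrite LZ// /a mulrAC -normrEsg ltr_pdivlMr.
  have saf := finite_simpleZ a sf.
  have [i _ /(_ i (leqnn i)) Hi] := cvgr_gt _ (cvgLcc saf) _ La.
  exists ((fun x => a * f x) \_ (cc i)), i; split => //.
  - exact: finite_simple_restrict.
  - by move=> x /fJ fx; rewrite patchE fx mulr0; case: ifP.
  - by move=> x nx; rewrite patchE memNset.
  - apply: (@le_trans _ _ (1 `^ q)); last by rewrite powR1.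
    apply: ge0_ler_powR; rewrite ?nnegrE ?Lseminorm_ge0//; first exact: ltW.
    rewrite Lseminorm_restrict; apply: (@le_trans _ _ (N (fun x => a * f x))).
      exact: le_Lseminorm.
    rewrite LseminormZ// /a normrM normfV (ger0_norm (ltW Nf0)) -mulrA mulVf ?gt_eqF// mulr1.
    by rewrite normr_sg lern1 leq_b1.
have many k : exists f i, [/\ finite_simple f, forall x, ~ cc i x -> f x = 0,
    k%:R * e <= L f & N f `^ q <= k%:R].
  elim: k => [|k [h [i [sh hi Lh Nh]]]].
    exists (cst 0), 0%N; split => //; first exact: finite_simple0.
      by rewrite mul0r L0.
    have -> : N (cst 0 : T -> R) = 0.
      have := LseminormZ q1 0 measurableT (@finite_simple0 R n).
      by rewrite normr0 mul0r; under eq_fun do rewrite mul0r.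
    by rewrite powR0// gt_eqF.
  have [f [i' [sf fi fi' Lf Nf]]] := unit i.
  exists (fun x => 1 * f x + h x), (maxn i i'); split.
  - exact: finite_simple_lin.
  - move=> x nx; rewrite fi' ?hi ?mulr0 ?addr0// => cx; apply: nx;
      by apply: centered_cube_le cx; rewrite ?leq_maxl ?leq_maxr.
  - by rewrite L_lin// mul1r -natr1 mulrDl mul1r addrC lerD// ltW.
  - rewrite (_ : (fun x => 1 * f x + h x) = (fun x => f x + h x)); last first.
      by apply/funext => x; rewrite mul1r.
    rewrite Lseminorm_powD//; first by rewrite -natr1 addrC lerD.
    by move=> x; have [/fi|/hi] := pselect (cc i x); [left|right].
pose q' := q / (q - 1).
have q'0 : 0 < q' by rewrite divr_gt0// subr_gt0.
pose k := (Num.truncn ((C / e) `^ q')).+1.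
have [f [_ [sf _ Lf Nf]]] := many k.
suff : k%:R <= (C / e) `^ q'.
  by apply/negP; rewrite -ltNge truncnS_gt.
have k0 : 0 < k%:R :> R by rewrite ltr0n.
have Nk : N f <= k%:R `^ q^-1.
  have -> : N f = (N f `^ q) `^ q^-1.
    by rewrite -powRrM mulfV ?gt_eqF// powRr1// Lseminorm_ge0.
  by apply: ge0_ler_powR; rewrite ?nnegrE ?powR_ge0 ?invr_ge0// ltW.
have : k%:R * e <= C * k%:R `^ q^-1.
  apply: (le_trans Lf); apply: (le_trans (ler_norm _)); apply: (le_trans (L_le sf)).
  by rewrite ler_wpM2l.
have {1}-> : k%:R = k%:R `^ q^-1 * k%:R `^ q'^-1 :> R.
  by rewrite -powRD ?(gt_eqF k0) ?implybT// hoelder_conjugate_sum// powRr1// ltW.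
rewrite -mulrA mulrC ler_pM2r ?powR_gt0// -ler_pdivlMr// => H.
have -> : k%:R = (k%:R `^ q'^-1) `^ q' :> R.
  by rewrite -powRrM mulVf ?gt_eqF// powRr1// ltW.
apply: ge0_ler_powR; rewrite ?nnegrE ?powR_ge0//; first exact: ltW.
by rewrite divr_ge0// ltW.
Qed.

Let exhausting_radii : exists j : nat -> nat,
  [/\ forall m, (m <= j m)%N, forall m, (j m <= j m.+1)%N &
      forall m f, finite_simple f -> (forall x, cc (j m) x -> f x = 0) ->
        `|L f| <= 2^-1 ^+ m * N f].
Proof.
have ex m : exists J, forall f, finite_simple f ->
    (forall x, cc J x -> f x = 0) -> `|L f| <= 2^-1 ^+ m * N f.
  by apply: tail_functional_small; rewrite exprn_gt0// invr_gt0.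
have [J HJ] := choice ex.
exists (fun m => m + \sum_(i < m.+1) J i)%N; split.
- by move=> m; exact: leq_addr.
- by move=> m; rewrite [in leqRHS]big_ord_recr/= leq_add// leq_addr.
- move=> m f sf fj; apply: HJ => // x Jx; apply: fj; apply: centered_cube_le Jx.
  by rewrite big_ord_recr/= addnA leq_addl.
Qed.

(** Restrictions of f to consecutive annuli add up to the restriction of f to a
    centered cube, on which L tends to L f by [Lseminorm_outside_cvg0]. *)
Lemma annuli_decomposition : exists (Q : nat -> set T) (Lam : nat -> (T -> R) -> R)
    (c : nat -> R),
  [/\ (forall k, cube (Q k)) /\ (forall k, 0 <= c k),
      forall k, \sum_(i < k) c i <= C + 2,
      forall k a f g, finite_simple f -> finite_simple g ->
        Lam k (fun x => a * f x + g x) = a * Lam k f + Lam k g,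
      forall k f, finite_simple f -> `|Lam k f| <= c k * Lseminorm q (Q k) f &
      forall f, finite_simple f -> series (Lam^~ f) @ \oo --> L f].
Proof.
have [j [jm jj jL]] := exhausting_radii.
pose A k := if k is k'.+1 then cc (j k) `\` cc (j k') else cc (j 0%N).
pose c k : R := if k is k'.+1 then 2^-1 ^+ k' else C.
have mA k : measurable (A k) by case: k => [|k] //=; exact: measurableD.
have Acc k : A k `<=` cc (j k) by case: k => [|k] //= x [].
have c0 k : 0 <= c k by case: k => [|k] //=; rewrite exprn_ge0// invr_ge0.
exists (fun k => cc (j k)), (fun k f => L (f \_ (A k))), c; split.
- by split => // k; exact: centered_cubeP.
- suff H k : \sum_(i < k.+1) c i = C + 2 - 2 * 2^-1 ^+ k.
    case=> [|k]; first by rewrite big_ord0 addr_ge0.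
    by rewrite H gerBl mulr_ge0// exprn_ge0// invr_ge0.
  elim: k => [|k IH]; first by rewrite big_ord_recr big_ord0/= add0r mulr1 addrK.
  rewrite big_ord_recr/= IH -addrA; congr (_ + _).
  by rewrite exprS mulrA mulfV// mul1r mulrDl !mul1r opprD -addrA addNr addr0.
- move=> k a f g sf sg; rewrite -L_lin; [|exact: finite_simple_restrict..].
  congr L; apply/funext => x; rewrite !patchE.
  by case: ifP => // _; rewrite mulr0 addr0.
- move=> k f sf; have sfA := finite_simple_restrict sf (mA k).
  apply: (@le_trans _ _ (c k * N (f \_ (A k)))).
    case: k sfA => [|k] sfA; first exact: L_le.
    apply: jL => // x jx; rewrite patchE memNset// => -[_]; exact.
  rewrite Lseminorm_restrict ler_wpM2l//; exact: le_Lseminorm.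
- move=> f sf.
  have sumE k : \sum_(0 <= i < k.+1) L (f \_ (A i)) = L (f \_ (cc (j k))).
    elim: k => [|k IH]; first by rewrite big_nat1.
    rewrite big_nat_recr//= IH -[X in X + _]mul1r -L_lin.
    + congr L; apply/funext => x; rewrite mul1r !patchE in_setD.
      have [xk|xk] := boolP (x \in cc (j k)); last first.
        by rewrite add0r /=; case: ifP => //; rewrite andbT => ->.
      rewrite andbF addr0 (_ : x \in cc (j k.+1))//.
      by move: xk; rewrite !inE; exact: centered_cube_le.
    + exact: finite_simple_restrict.
    + exact: (finite_simple_restrict sf (mA k.+1)).
  apply/cvgrPdist_le => e e0.
  have /cvgrPdist_le/(_ _ e0)[k0 _ Hk0] := cvgLcc sf.
  exists k0.+1 => // -[//|k] /= k0k; rewrite /series/= sumE.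
  apply: Hk0 => /=; exact: leq_trans (jm k).
Qed.

End equal_case.

Lemma predual_equal (R : realType) (n : nat) (q : R) (L : (Rn R n -> R) -> R) :
  1 < q -> dual (morrey_tilde q q) (morrey_norm q q) L ->
  exists2 g : Rn R n -> R, block_space q q g &
    forall f : Rn R n -> R, morrey_tilde q q f ->
      (lebesgue_Rn R n).-integrable setT (EFin \o (f \* g)) /\
      L f = \int[lebesgue_Rn R n]_x (f x * g x).
Proof.
move=> q1 LP; have [L_lin [CL L_le]] := LP.
have tilde (f : Rn R n -> R) : finite_simple f -> morrey_tilde q q f.
  exact: finite_simple_tilde.
have [|||Q [Lam [c [[cQ c0] cC Lam_lin Lam_le Lam_cvg]]]] :=
  @annuli_decomposition R n q q1 L `|CL|.
- exact: normr_ge0.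
- by move=> a f g sf sg; apply: L_lin; exact: tilde.
- move=> f sf; have := L_le f (tilde f sf).
  have Nfin : morrey_norm q q f \is a fin_num.
    by rewrite ge0_fin_numE ?(tilde_morrey_norm (tilde f sf))// morrey_norm_ge0.
  have := morrey_norm_le_Lseminorm q1 sf.
  rewrite -(fineK Nfin) -EFinM !lee_fin => H /le_trans; apply.
  apply: (@le_trans _ _ (`|CL| * fine (morrey_norm q q f))).
    by rewrite ler_wpM2r ?ler_norm// fine_ge0// morrey_norm_ge0.
  by rewrite ler_wpM2l.
apply: (dual_of_local_functionals q1 (lexx q) LP cQ c0 cC Lam_lin) => // k f sf.
by rewrite subrr powRr0 mul1r; exact: Lam_le.
Qed.

(** * The predual of the block space *)

Theorem theorem4p3 (R : realType) (n : nat) (p q : R) :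
  (0 < n)%N -> 1 < q -> q <= p ->
  (forall g : Rn R n -> R, block_space p q g ->
     (forall f : Rn R n -> R, morrey_tilde p q f ->
        (lebesgue_Rn R n).-integrable setT (EFin \o (f \* g))) /\
     dual (morrey_tilde p q) (morrey_norm p q)
       (fun f : Rn R n -> R => \int[lebesgue_Rn R n]_x (f x * g x))) /\
  (forall L : (Rn R n -> R) -> R,
     dual (morrey_tilde p q) (morrey_norm p q) L ->
     exists2 g : Rn R n -> R, block_space p q g &
       forall f : Rn R n -> R, morrey_tilde p q f ->
         (lebesgue_Rn R n).-integrable setT (EFin \o (f \* g)) /\
         L f = \int[lebesgue_Rn R n]_x (f x * g x)).
Proof.
move=> n0 q1 qp; split; first exact: block_space_dual.
move=> L; move: qp; rewrite le_eqVlt => /predU1P[<-|qp] LP.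
  exact: predual_equal.
exact: predual_strict.
Qed.
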